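(* Let $\mathfrak{g}$ be a finite-dimensional complex simple Lie algebra with canonical basis $\mathcal{A}$ as in the context. If $\phi:\mathfrak{g}\to\mathfrak{gl}(V)$ and $\psi:\mathfrak{g}\to\mathfrak{gl}(W)$ are finite-dimensional representations with $f_\phi=f_\psi$, then $V$ and $W$ are isomorphic as $\mathfrak{g}$-modules. That is, the $\mathfrak{g}$-module structure of a finite-dimensional representation is uniquely determined (up to isomorphism) by its characteristic polynomial.
   Context: Fix a Cartan subalgebra $\mathfrak{h}$ of $\mathfrak{g}$ with root system $\Phi$, simple roots $\alpha_1,\dots,\alpha_n$, coroots $h_{\alpha_1},\dots,h_{\alpha_n}$ (a basis of $\mathfrak{h}$) and root vectors $E_\alpha$, $\alpha\in\Phi$; the canonical basis is $\mathcal{A}=(h_{\alpha_1},\dots,h_{\alpha_n},E_\alpha\ (\alpha\in\Phi))$. For a finite-dimensional representation $\phi:\mathfrak{g}\to\mathfrak{gl}(V)$, its characteristic polynomial is $f_\phi(z)=\det\big(z_0I+\sum_{i=1}^n z_i\phi(h_{\alpha_i})+\sum_{\alpha\in\Phi}z_\alpha\phi(E_\alpha)\big)$ in indeterminates $z_0,z_1,\dots,z_n,z_\alpha$ ($\alpha\in\Phi$). *)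

(* Defs.v *)
From HB Require Import structures.
From mathcomp Require Import all_boot all_order all_algebra.
From mathcomp Require Import reals.
From mathcomp Require Import complex.
From mathcomp Require Import mpoly.

Set Implicit Arguments.
Unset Strict Implicit.
Unset Printing Implicit Defensive.

Import Order.TTheory GRing.Theory Num.Theory.
Local Open Scope ring_scope.

Section LieDefs.
Variable C : fieldType.
Variable L : vectType C.
Variable br : L -> L -> L.

Definition lie_algebra : Prop :=
  [/\ forall y a x1 x2, br (a *: x1 + x2) y = a *: br x1 y + br x2 y,
      forall x a y1 y2, br x (a *: y1 + y2) = a *: br x y1 + br x y2,
      forall x, br x x = 0 &
      forall x y z, br x (br y z) + br y (br z x) + br z (br x y) = 0].

Definition lie_ideal (I : {vspace L}) : Prop :=
  forall x y, y \in I -> br x y \in I.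

Definition simple_lie : Prop :=
  [/\ lie_algebra,
      exists x y, br x y != 0 &
      forall I : {vspace L}, lie_ideal I -> I = 0%VS \/ I = fullv].

Definition subalgebra (h : {vspace L}) : Prop :=
  forall x y, x \in h -> y \in h -> br x y \in h.

Definition nilpotent_subalgebra (h : {vspace L}) : Prop :=
  exists k : nat, forall (xs : 'I_k -> L) (y : L),
    (forall i, xs i \in h) -> y \in h ->
    foldr (fun i acc => br (xs i) acc) y (enum 'I_k) = 0.

Definition self_normalizing (h : {vspace L}) : Prop :=
  forall x, (forall y, y \in h -> br x y \in h) -> x \in h.

Definition cartan_subalgebra (h : {vspace L}) : Prop :=
  [/\ subalgebra h, nilpotent_subalgebra h & self_normalizing h].

(* linear functionals are represented by linear maps L -> C, only their
   restriction to h matters *)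
Definition lin_functional (lam : L -> C) : Prop :=
  forall a x y, lam (a *: x + y) = a * lam x + lam y.

Definition eq_on (h : {vspace L}) (l1 l2 : L -> C) : Prop :=
  forall y, y \in h -> l1 y = l2 y.

Definition in_weight_space (h : {vspace L}) (lam : L -> C) (x : L) : Prop :=
  forall y, y \in h -> br y x = lam y *: x.

Definition root_system (h : {vspace L}) (Phi : finType) (alpha : Phi -> L -> C)
  : Prop :=
  [/\ forall r, lin_functional (alpha r),
      forall r, exists2 y, y \in h & alpha r y != 0,
      forall r, exists2 x, x != 0 & in_weight_space h (alpha r) x,
      forall r1 r2, eq_on h (alpha r1) (alpha r2) -> r1 = r2 &
      forall lam, lin_functional lam ->
        (exists2 y, y \in h & lam y != 0) ->
        (exists2 x, x != 0 & in_weight_space h lam x) ->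
        exists r, eq_on h (alpha r) lam].

Definition simple_roots (h : {vspace L}) (Phi : finType) (alpha : Phi -> L -> C)
  (n : nat) (s : 'I_n -> Phi) : Prop :=
  [/\ n = \dim h,
      forall c : 'I_n -> C,
        (forall y, y \in h -> \sum_i c i * alpha (s i) y = 0) ->
        forall i, c i = 0 &
      forall r, exists c : 'I_n -> int,
        ((forall i, 0 <= c i) \/ (forall i, c i <= 0)) /\
        eq_on h (alpha r) (fun y => \sum_i (c i)%:~R * alpha (s i) y)].

Definition coroot (h : {vspace L}) (lam : L -> C) (hv : L) : Prop :=
  [/\ hv \in h,
      exists x z, [/\ in_weight_space h lam x,
                      in_weight_space h (fun y => - lam y) z & hv = br x z] &
      lam hv = 2].

Definition canonical_basis_data (h : {vspace L}) (Phi : finType)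
  (alpha : Phi -> L -> C) (n : nat) (s : 'I_n -> Phi) (hc : 'I_n -> L)
  (E : Phi -> L) : Prop :=
  [/\ cartan_subalgebra h,
      root_system h alpha,
      simple_roots h alpha s,
      forall i, coroot h (alpha (s i)) (hc i) &
      forall r, E r != 0 /\ in_weight_space h (alpha r) (E r)].

(* finite-dimensional representation on V = C^m (column vectors) *)
Definition lie_rep (m : nat) (phi : L -> 'M[C]_m) : Prop :=
  (forall a x y, phi (a *: x + y) = a *: phi x + phi y) /\
  (forall x y, phi (br x y) = phi x *m phi y - phi y *m phi x).

Definition rep_iso (m k : nat) (phi : L -> 'M[C]_m) (psi : L -> 'M[C]_k)
  : Prop :=
  exists T : 'M[C]_(k, m),
    [/\ row_free T, row_full T & forall x, T *m phi x = psi x *m T].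

Definition lie_charpoly (n : nat) (Phi : finType) (hc : 'I_n -> L)
  (E : Phi -> L) (m : nat) (phi : L -> 'M[C]_m)
  : {mpoly C[(1 + n + #|Phi|)%N]} :=
  let z0 := lshift #|Phi| (lshift n (ord0 : 'I_1)) in
  let zi i := lshift #|Phi| (rshift 1 i) in
  let zr r := rshift (1 + n) (enum_rank r) in
  \det ((('X_z0 : {mpoly C[(1 + n + #|Phi|)%N]})%:M : 'M_m)
        + \sum_(i < n) 'X_(zi i) *: map_mx (fun c => c%:MP) (phi (hc i))
        + \sum_(r : Phi) 'X_(zr r) *: map_mx (fun c => c%:MP) (phi (E r))).

End LieDefs.

(* Main.v *)
Require Import Defs.
From HB Require Import structures.
From mathcomp Require Import all_boot all_order all_algebra.
From mathcomp Require Import reals.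
From mathcomp Require Import complex.
From mathcomp Require Import mpoly.
From mathcomp Require Import ring.
From Stdlib Require Import Classical_Prop.
Import Order.TTheory GRing.Theory Num.Theory.
Local Open Scope ring_scope.
Set Implicit Arguments.
Unset Strict Implicit.
Unset Printing Implicit Defensive.

(** Restrict the characteristic polynomials to [h]. The coroots span [h], because
    the Killing form pairs [hc i] with [y] to a nonzero multiple of [alpha (s i) y]. So
    [tr (phi x ^ j) = tr (psi x ^ j)] for [x] in [h]. The difference [tau] of the
    two traces is a functional on the enveloping algebra; by induction on the
    filtration it is symmetric and invariant on the graded pieces and vanishes on [h], and
    an element [h0] of [h] with [L = h + [L, h0]] (a Cartan subalgebra has one) forces
    [tau = 0], as in the injectivity half of Chevalley's restriction theorem.

    Weyl's theorem is used through Whitehead's lemma. The trace form of a nontrivial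
    representation is nonzero on a coroot, since an sl2-triple makes the eigenvalues of the
    coroot real; hence it is nondegenerate by simplicity, and its Casimir element acts
    invertibly on irreducible modules.

    A module without invariants admits an element of the augmentation ideal acting as the
    identity, so traces on the enveloping algebra detect invariants. Comparing [Hom(W, W)]
    and [Hom(W, V)] gives a nonzero intertwiner; its kernel and cokernel have the same
    traces again, hence are isomorphic by induction, and the pieces are glued by
    equivariant splittings. *)

(** * Traces of powers and eigenvalues *)

Section Triangularization.
Variable F : numClosedFieldType.

Lemma trig_mulmx n (A B : 'M[F]_n) : is_trig_mx A -> is_trig_mx B ->
  is_trig_mx (A *m B) /\ forall i, (A *m B) i i = A i i * B i i.
Proof.
move=> /is_trig_mxP tA /is_trig_mxP tB; split.
  apply/is_trig_mxP => i j ltij; rewrite mxE big1 // => l _.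
  have [ltil|leli] := ltnP i l; first by rewrite tA // mul0r.
  by rewrite tB ?mulr0 // (leq_ltn_trans leli).
move=> i; rewrite mxE (bigD1 i) //= big1 ?addr0 // => l neli.
have [ltil|leli] := ltnP i l; first by rewrite tA // mul0r.
by rewrite tB ?mulr0 // ltn_neqAle leli andbT.
Qed.

Lemma trig_exp n (A : 'M[F]_n) j : is_trig_mx A ->
  is_trig_mx (A ^+ j) /\ forall i, (A ^+ j) i i = A i i ^+ j.
Proof.
move=> tA; elim: j => [|j [tj dj]].
  split=> [|i]; last by rewrite !expr0 mxE eqxx.
  by rewrite expr0; apply/is_trig_mxP => i l lt; rewrite mxE -val_eqE /= ltn_eqF.
have [t d] := trig_mulmx tA tj.
by split=> [|i]; rewrite exprS // d dj exprS.
Qed.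

Lemma trig_similar n (A : 'M[F]_n) :
  exists P T : 'M[F]_n, [/\ P \in unitmx, is_trig_mx T & A = invmx P *m T *m P].
Proof.
case: n A => [|n] A.
  by exists 1%:M, A; rewrite unitmx1 invmx1 mul1mx mulmx1; split=> //; apply/is_trig_mxP => -[].
have [//|P unP tP] := Schur A.
have uP := unitarymx_unit unP.
exists P, (conjmx P A); split=> //.
by rewrite conjumx // !mulmxA mulVmx // mul1mx mulmxKV.
Qed.

Lemma exp_conjmx n (P T : 'M[F]_n) j : P \in unitmx ->
  (invmx P *m T *m P) ^+ j = invmx P *m T ^+ j *m P.
Proof.
move=> uP; elim: j => [|j IH]; first by rewrite !expr0 mulmx1 mulVmx.
rewrite !exprS IH -!mulmxE !mulmxA; congr (_ *m _ *m _).
by rewrite mulmxK.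
Qed.

(** The list [s] is the diagonal of a triangular form given by Schur's theorem. It lets the
    characteristic polynomial determine all traces of powers. *)
Lemma trace_pow_eigenvalues n (A : 'M[F]_n) :
  exists2 s : seq F, char_poly A = \prod_(a <- s) ('X - a%:P)
    & forall j, \tr (A ^+ j) = \sum_(a <- s) a ^+ j.
Proof.
have [P [T [uP tT ->]]] := trig_similar A.
exists [seq T i i | i : 'I_n] => [|j].
  rewrite (_ : char_poly _ = char_poly T).
    by rewrite char_poly_trig // big_image.
  rewrite /char_poly /char_poly_mx.
  have -> : 'X%:M - map_mx polyC (invmx P *m T *m P) =
     map_mx polyC (invmx P) *m ('X%:M - map_mx polyC T) *m map_mx polyC P.
    rewrite mulmxBr mulmxBl !map_mxM; congr (_ - _).
    by rewrite scalar_mxC -mulmxA -map_mxM mulVmx // map_mx1 mulmx1.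
  by rewrite !det_mulmx mulrAC -det_mulmx -map_mxM mulVmx // map_mx1 det1 mul1r.
have [t d] := trig_exp j tT.
rewrite exp_conjmx // mxtrace_mulC mulmxA mulmxV // mul1mx big_image.
by apply: eq_bigr => i _; rewrite d.
Qed.

Lemma trace_pow_char_poly m k (A : 'M[F]_m) (B : 'M[F]_k) j :
  char_poly A = char_poly B -> \tr (A ^+ j) = \tr (B ^+ j).
Proof.
have [s cs ts] := trace_pow_eigenvalues A.
have [t ct tt] := trace_pow_eigenvalues B.
rewrite cs ct ts tt => /prod_XsubC_eq st; exact: perm_big.
Qed.

Lemma char_polyXn_nilp n (A : 'M[F]_n) N : char_poly A = 'X^N -> A ^+ N = 0.
Proof.
case: n A => [|n] A cA; first by rewrite [LHS]flatmx0 [RHS]flatmx0.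
by have := Cayley_Hamilton A; rewrite cA rmorphXn /= horner_mx_X.
Qed.

End Triangularization.

(** * sl2-triples of matrices *)

Section Sl2.
Variable F : numClosedFieldType.

(** Otherwise [g 0], ..., [g n] would be [n + 1] distinct roots of a polynomial of degree [n]. *)
Lemma eigenvectors_vanish n (A : 'M[F]_n) (v : nat -> 'rV[F]_n) (g : nat -> F) :
  injective g -> (forall i, v i *m A = g i *: v i) -> exists i, v i = 0.
Proof.
move=> gI vg; apply: NNPP => nv.
have v0 i : v i != 0 by apply/eqP => vi; apply: nv; exists i.
have rg i : root (char_poly A) (g i).
  by rewrite -eigenvalue_root_char; apply/eigenvalueP; exists (v i).
have := @max_poly_roots _ (char_poly A) (map g (iota 0 n.+1)).
rewrite -size_poly_eq0 size_char_poly => /(_ isT).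
rewrite map_inj_uniq ?iota_uniq // size_map size_iota ltnn => H.
by suff: false by []; apply: H => //; apply/allP => x /mapP [i _ ->].
Qed.

Lemma first_vanishing n (v : nat -> 'rV[F]_n) :
  v 0%N != 0 -> (exists i, v i = 0) -> exists i, v i != 0 /\ v i.+1 = 0.
Proof.
move=> v0 [i vi]; elim: i vi => [/eqP|i IH vi]; first by rewrite (negPf v0).
by have [/IH //|ni] := eqVneq (v i) 0; exists i.
Qed.

Variables (n : nat) (e h f : 'M[F]_n).
Hypothesis he : h *m e - e *m h = 2 *: e.
Hypothesis hf : h *m f - f *m h = - 2 *: f.
Hypothesis ef : e *m f - f *m e = h.

(** Matrices act on row vectors from the right, so [e] lowers the eigenvalues of [h] by 2 and [f]
    raises them. *)
Lemma sl2_shift_e (v : 'rV[F]_n) l i : v *m h = l *: v ->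
  (v *m e ^+ i) *m h = (l - (2 * i)%:R) *: (v *m e ^+ i).
Proof.
move=> vh; elim: i => [|i IH]; first by rewrite expr0 mulmx1 vh subr0.
rewrite exprSr mulmxA -mulmxA.
have -> : e *m h = h *m e - 2 *: e by rewrite -he opprB addrC subrK.
rewrite mulmxBr mulmxA IH -scalemxAl -scalemxAr -scalerBl; congr (_ *: _).
by rewrite mulnS natrD; ring.
Qed.

Lemma sl2_shift_f (v : 'rV[F]_n) l i : v *m h = l *: v ->
  (v *m f ^+ i) *m h = (l + (2 * i)%:R) *: (v *m f ^+ i).
Proof.
move=> vh; elim: i => [|i IH]; first by rewrite expr0 mulmx1 vh addr0.
rewrite exprSr mulmxA -mulmxA.
have -> : f *m h = h *m f + 2 *: f by rewrite -[2 *: f]opprK -scaleNr -hf opprB addrC subrK.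
rewrite mulmxDr mulmxA IH -scalemxAl -scalemxAr -scalerDl; congr (_ *: _).
by rewrite mulnS natrD; ring.
Qed.

Lemma sl2_string (w : 'rV[F]_n) l i : w *m h = l *: w -> w *m f = 0 ->
  (w *m e ^+ i.+1) *m f = (i.+1%:R * (l - i%:R)) *: (w *m e ^+ i).
Proof.
move=> wh wf.
have ef' : e *m f = f *m e + h by rewrite -ef addrC subrK.
elim: i => [|i IH].
  by rewrite expr1 expr0 mulmx1 -mulmxA ef' mulmxDr mulmxA wf mul0mx add0r wh subr0 mul1r.
rewrite exprSr mulmxA -mulmxA ef' mulmxDr (mulmxA _ f) IH (sl2_shift_e _ wh).
rewrite -scalemxAl -mulmxA mulmxE -exprSr -scalerDl; congr (_ *: _).
by rewrite mulnS natrD -[i.+2]addn1 natrD -[i.+1]addn1 natrD natrM; ring.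
Qed.

(** Climb with [f] to a vector [w] killed by [f], of eigenvalue [mu = l + 2 i], then descend with
    [e] until [w e^(j+1) = 0]. The string formula forces [mu = j], so [l] is even an integer. *)
Lemma sl2_eigenvalue_real l : eigenvalue h l -> l \is Num.real.
Proof.
case/eigenvalueP => v vh v0.
(* The sign [s] serves both the climb, with eigenvalues [l + 2 i], and the descent, with eigenvalues
   [mu - 2 j]. *)
have inj2 (s : bool) (a : F) : injective (fun i => a + (-1) ^+ s * (2 * i)%:R).
  move=> i j /addrI /(mulfI _); rewrite signr_eq0 => /(_ isT) /eqP.
  by rewrite eqr_nat eqn_mul2l => /eqP.
have [i [wn0 w1]] : exists i, v *m f ^+ i != 0 /\ v *m f ^+ i.+1 = 0.
  apply: (first_vanishing (v := fun i => v *m f ^+ i)); first by rewrite expr0 mulmx1.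
  apply: (eigenvectors_vanish (inj2 false l)) => i.
  by rewrite expr0 mul1r; apply: sl2_shift_f.
have wh := sl2_shift_f i vh; set w := v *m f ^+ i in wn0 wh.
have wf : w *m f = 0 by rewrite -mulmxA mulmxE -exprSr.
set mu := l + _ in wh.
have [j [xn0 x1]] : exists j, w *m e ^+ j != 0 /\ w *m e ^+ j.+1 = 0.
  apply: (first_vanishing (v := fun i => w *m e ^+ i)); first by rewrite expr0 mulmx1.
  apply: (eigenvectors_vanish (inj2 true mu)) => j.
  by rewrite expr1 mulN1r; apply: sl2_shift_e.
have /esym/eqP := sl2_string j wh wf.
rewrite x1 mul0mx scaler_eq0 (negPf xn0) orbF mulf_eq0 pnatr_eq0 /= subr_eq0 => /eqP muj.
have -> : l = j%:R - (2 * i)%:R by rewrite -muj addrK.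
by rewrite rpredB // realn.
Qed.

(** The trace is a sum of squares of real numbers, so all eigenvalues of [h] vanish and
    [h ^+ N = 0]. Moving [e] across gives [0 = h^N e = e (h + 2)^N], and [h + 2] is invertible. *)
Lemma sl2_trace_sqr_eq0 : \tr (h *m h) = 0 -> e = 0.
Proof.
have [s cs ts] := trace_pow_eigenvalues h.
rewrite mulmxE -expr2 ts => s0.
have eig a : a \in s -> eigenvalue h a.
  by rewrite eigenvalue_root_char cs root_prod_XsubC.
have {s0} s0 a : a \in s -> a = 0.
  move=> sa; move/eqP: s0; rewrite big_seq psumr_eq0; last first.
    by move=> b sb; rewrite real_exprn_even_ge0 // sl2_eigenvalue_real ?eig.
  by move/allP => /(_ _ sa); rewrite sa expf_eq0 /= => /eqP.
have hN : h ^+ size s = 0.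
  apply: char_polyXn_nilp.
    rewrite cs big_seq (eq_bigr (fun=> 'X)) => [|a sa]; last by rewrite (s0 _ sa) subr0.
    by rewrite -big_seq big_const_seq count_predT iter_mulr_1.
have heN j : h ^+ j *m e = e *m (h + 2%:M) ^+ j.
  elim: j => [|j IH]; first by rewrite !expr0 mulmx1 mul1mx.
  rewrite exprS -mulmxE -mulmxA IH mulmxA [in RHS]exprS -mulmxE mulmxA; congr (_ *m _).
  by rewrite mulmxDr mul_mx_scalar -he addrC subrK.
have u : h + 2%:M \in unitmx.
  have : ~~ eigenvalue h (-2).
    rewrite eigenvalue_root_char cs root_prod_XsubC; apply/negP => /s0/eqP.
    by rewrite oppr_eq0 pnatr_eq0.
  rewrite /eigenvalue /eigenspace negbK kermx_eq0 row_free_unit.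
  by rewrite raddfN /= opprK.
have := heN (size s); rewrite hN mul0mx => /esym e0.
have uX : (h + 2%:M) ^+ size s \in unitmx.
  elim: (size s) => [|j IH]; first by rewrite expr0 unitmx1.
  by rewrite exprS -mulmxE unitmx_mul u.
by rewrite -[e](mulmxK uX) e0 mul0mx.
Qed.

End Sl2.

(** * Subspaces and subquotients in matrix form *)

Section Subspaces.
Variable F : fieldType.

(** Classical: a subspace inside [S] is enlarged by vectors of [S] outside it until there are none;
    the codimension bounds the number of steps. *)
Lemma vspace_of_pred (V : vectType F) (S : V -> Prop) :
  S 0 -> (forall a u v, S u -> S v -> S (a *: u + v)) ->
  exists U : {vspace V}, forall v, S v <-> v \in U.
Proof.
move=> S0 SD.
suff step : forall d (U : {vspace V}), (\dim {:V} - \dim U < d)%N ->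
    (forall v, v \in U -> S v) -> exists U : {vspace V}, forall v, S v <-> v \in U.
  by apply: (step _ 0%VS (ltnSn _)) => v; rewrite memv0 => /eqP ->.
elim=> [|d IH] U //; rewrite ltnS => dU US.
have [[v [Sv vU]]|nv] := classic (exists v, S v /\ v \notin U); last first.
  exists U => v; split=> [Sv|/US //]; apply/negPn/negP => vU; apply: nv.
  by exists v.
have vUv : v \in (U + <[v]>)%VS by rewrite (subvP (addvSr _ _)) ?memv_line.
apply: (IH (U + <[v]>)%VS) => [|w /memv_addP [u uU [w' /vlineP [k ->] ->]]]; last first.
  by rewrite addrC; apply: SD => //; apply: US.
have ltU : (\dim U < \dim (U + <[v]>))%N.
  rewrite (ltn_leqif (dimv_leqif_sup (addvSl _ _))).
  by apply: contra vU => /subvP -> .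
have lev := dimvS (subvf (U + <[v]>)%VS).
by apply: leq_trans dU; apply: ltn_sub2l => //; apply: leq_trans lev.
Qed.

Lemma mx_of_pred d (S : 'rV[F]_d -> Prop) :
  S 0 -> (forall a u v, S u -> S v -> S (a *: u + v)) ->
  exists N : 'M[F]_d, forall v : 'rV_d, S v <-> (v <= N)%MS.
Proof.
move=> S0 SD; have [U SU] := vspace_of_pred S0 SD.
pose N := (\matrix_(i < \dim U) (vbasis U)`_i)%MS.
exists <<N>>%MS => v; rewrite genmxE; split=> [/SU vU|/submxP [w ->]].
  rewrite (coord_vbasis vU); apply: summx_sub => i _; apply: scalemx_sub.
  by rewrite -[_`_i](rowK (fun i : 'I_(\dim U) => (vbasis U)`_i)) row_sub.
apply/SU; rewrite mulmx_sum_row; apply: memv_suml => i _; apply: memvZ.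
by rewrite rowK; apply: vbasis_mem; apply: mem_nth; rewrite size_tuple.
Qed.

(* [A |-> K *m A *m C] is the matrix of [A] on the quotient [N2 / N1]. *)
Definition quot_basis d r (N1 N2 : 'M[F]_d) (K : 'M[F]_(r, d)) (C : 'M[F]_(d, r)) :=
  [/\ K *m C = 1%:M, N1 *m C = 0, (K <= N2)%MS &
      forall p (A : 'M[F]_(p, d)), (A <= N2)%MS -> (A - A *m C *m K <= N1)%MS].

Lemma quot_basis_exists d (N1 N2 : 'M[F]_d) : (N1 <= N2)%MS ->
  exists r K C, @quot_basis d r N1 N2 K C.
Proof.
move=> le12; set M := (N2 :\: N1)%MS.
have capM : (N1 :&: M)%MS = 0 by rewrite capmxC /M capmx_diff.
have eqM : (M + N1 :=: N2)%MS.
  apply: eqmx_trans (addsmx_diff_cap_eq N2 N1); apply: adds_eqmx => //.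
  apply/eqmxP; rewrite capmxSr sub_capmx submx_refl le12 //.
pose J := col_mx (row_base N1) (row_base M).
have fJ : row_free J.
  rewrite -row_leq_rank -addsmxE.
  have dx : mxdirect (row_base N1 + row_base M).
    apply/mxdirect_addsP/eqP; rewrite -submx0 -capM.
    by apply: capmxS; rewrite eq_row_base.
  by rewrite (mxdirectP dx) /= !eq_row_base.
have [R JR] := row_freeP fJ.
(* [R] is a right inverse of the stacked bases [J], so this [C] kills [N1] and reads off coordinates
   along the complement [M]. *)
exists (\rank M), (row_base M), (R *m col_mx 0 1%:M).
have : J *m (R *m col_mx 0 1%:M) = col_mx 0 1%:M by rewrite mulmxA JR mul1mx.
rewrite mul_col_mx => /eq_col_mx [R1 R2].
have N1C : N1 *m (R *m col_mx 0 1%:M) = 0.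
  have /submxP [w {1}->] : (N1 <= row_base N1)%MS by rewrite eq_row_base.
  by rewrite -mulmxA R1 mulmx0.
split=> //.
  by rewrite eq_row_base diffmxSl.
move=> p A; rewrite -eqM => /sub_addsmxP [[u1 u2]] /= ->.
have /submxP [w ->] : (u1 *m M <= row_base M)%MS by rewrite eq_row_base submxMl.
rewrite mulmxDl -(mulmxA w) -(mulmxA u2) N1C R2 mulmx0 addr0 mulmx1.
by rewrite addrAC subrr add0r submxMl.
Qed.

(** Since [A] keeps [N2], the rows of [K *m A] agree with those of [K *m A *m C *m K] modulo [N1];
    since [B] keeps [N1], this error dies under [B *m C]. *)
Lemma quot_mulmx d r (N1 N2 : 'M[F]_d) (K : 'M[F]_(r, d)) C (A B : 'M[F]_d) :
  quot_basis N1 N2 K C -> stablemx N2 A -> stablemx N1 B ->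
  (K *m A *m C) *m (K *m B *m C) = K *m (A *m B) *m C.
Proof.
case=> KC N1C KN2 sub s2 s1.
have /sub : (K *m A <= N2)%MS by apply: submx_trans s2; apply: submxMr.
case/submxP => w Ew.
have : (K *m A - K *m A *m C *m K) *m (B *m C) = 0.
  case/submxP: s1 => w1 E1.
  by rewrite Ew -!mulmxA (mulmxA N1) E1 -!mulmxA N1C !mulmx0.
by move/eqP; rewrite mulmxBl subr_eq0 !mulmxA => /eqP ->.
Qed.

Lemma quot_exp d r (N1 N2 : 'M[F]_d) (K : 'M[F]_(r, d)) C (A : 'M[F]_d) j :
  quot_basis N1 N2 K C -> stablemx N2 A -> stablemx N1 A ->
  (K *m A *m C) ^+ j = K *m A ^+ j *m C.
Proof.
move=> qb s2 s1; elim: j => [|j IH]; first by case: qb => KC *; rewrite !expr0 mulmx1 KC.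
rewrite !exprS IH -!mulmxE (quot_mulmx qb) //.
elim: j {IH} => [|j IH]; first by rewrite expr0 mulmx1.
by rewrite exprSr -mulmxE mulmxA (submx_trans (submxMr _ IH)).
Qed.

Lemma sub_quot0 d r (N1 N2 : 'M[F]_d) (K : 'M[F]_(r, d)) C p (A : 'M[F]_(p, d)) :
  quot_basis N1 N2 K C -> (A <= N2)%MS -> A *m C = 0 -> (A <= N1)%MS.
Proof. by case=> _ _ _ sub /sub leA AC0; move: leA; rewrite AC0 mul0mx subr0. Qed.

Lemma quot0_sub d r (N1 N2 : 'M[F]_d) (K : 'M[F]_(r, d)) C p (A : 'M[F]_(p, d)) :
  quot_basis N1 N2 K C -> (A <= N1)%MS -> A *m C = 0.
Proof. by case=> _ N1C _ _ /submxP [w ->]; rewrite -mulmxA N1C mulmx0. Qed.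

Lemma trace_sub_quot d r1 r2 (N A : 'M[F]_d) (K1 : 'M[F]_(r1, d)) C1 (K2 : 'M[F]_(r2, d)) C2 :
  quot_basis 0 N K1 C1 -> quot_basis N 1%:M K2 C2 -> stablemx N A ->
  \tr A = \tr (K1 *m A *m C1) + \tr (K2 *m A *m C2).
Proof.
move=> q1 q2 sA; have [K1C1 _ K1N sub1] := q1; have [_ _ _ sub2] := q2.
(* The rows of [1 - C2 K2] lie in [N], where [C1 K1] acts as the identity. This splits the trace of
   [A] into its part on [N] and its part on the quotient. *)
have /sub1 := sub2 _ 1%:M (submx1 _); rewrite submx0 mul1mx => /eqP E.
have K1A : K1 *m A *m C2 = 0.
  by apply: (quot0_sub q2); apply: submx_trans sA; apply: submxMr.
have -> : \tr (K1 *m A *m C1) = \tr (A *m (1%:M - C2 *m K2)).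
  move/eqP: E; rewrite subr_eq0 => /eqP ->.
  rewrite !mulmxA [in RHS]mxtrace_mulC !mulmxA; congr (\tr (_ *m _)).
  by rewrite mulmxBr mulmx1 !mulmxA K1A mul0mx subr0.
rewrite mulmxBr mulmx1 raddfB /= mulmxA [\tr (A *m C2 *m K2)]mxtrace_mulC mulmxA.
by rewrite subrK.
Qed.

End Subspaces.

(** * Consequences of the one-equation form of linearity *)

Section LinearFun.
Variables (F : fieldType) (V W : lmodType F) (f : V -> W).
Hypothesis flin : forall a x y, f (a *: x + y) = a *: f x + f y.

Lemma lin0 : f 0 = 0.
Proof. by have := flin (-1) 0 0; rewrite scaler0 addr0 scaleN1r addNr. Qed.

Lemma linZ a x : f (a *: x) = a *: f x.
Proof. by rewrite -[a *: x]addr0 flin lin0 addr0. Qed.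

Lemma linD x y : f (x + y) = f x + f y.
Proof. by rewrite -{1}[x]scale1r flin scale1r. Qed.

Lemma linN x : f (- x) = - f x.
Proof. by rewrite -scaleN1r linZ scaleN1r. Qed.

Lemma lin_sum (I : Type) (r : seq I) (P : pred I) (g : I -> V) :
  f (\sum_(i <- r | P i) g i) = \sum_(i <- r | P i) f (g i).
Proof. exact: (big_morph _ linD lin0). Qed.

End LinearFun.

(** * Ideals of a simple Lie algebra and the adjoint representation *)

Section LieAlgebra.
Variables (F : fieldType) (L : vectType F) (br : L -> L -> L).
Hypothesis lieL : lie_algebra br.

Let brl y : forall a x1 x2, br (a *: x1 + x2) y = a *: br x1 y + br x2 y.
Proof. by case: lieL => + _ _ _; apply. Qed.

Let brr x : forall a y1 y2, br x (a *: y1 + y2) = a *: br x y1 + br x y2.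
Proof. by case: lieL => _ + _ _; apply. Qed.

Lemma br_anti x y : br x y = - br y x.
Proof.
case: lieL => _ _ brxx _; apply/eqP; rewrite -addr_eq0; apply/eqP.
have := brxx (x + y); rewrite (linD (brl _)) !(linD (brr _)) !brxx.
by rewrite add0r addr0.
Qed.

Lemma br_jacobi z x y : br z (br x y) = br (br z x) y - br (br z y) x.
Proof.
case: lieL => _ _ _ jac; have := jac z x y.
rewrite (br_anti x (br y z)) (br_anti y (br z x)) (br_anti y z) (linN (brl _)) opprK.
by move=> /eqP; rewrite -addrA addr_eq0 opprD opprK addrC => /eqP.
Qed.

Lemma simple_ideal (S : L -> Prop) : simple_lie br ->
  S 0 -> (forall a u v, S u -> S v -> S (a *: u + v)) ->
  (forall x y, S y -> S (br x y)) -> (exists2 x, S x & x != 0) -> forall x, S x.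
Proof.
case=> _ _ simpL S0 SD Sid [x0 Sx0 x0n] x.
have [U SU] := vspace_of_pred S0 SD.
case: (simpL U) => [u v|U0|Uf]; first by move/SU/Sid => /(_ u)/SU.
  by move/SU: Sx0; rewrite U0 memv0 (negPf x0n).
by apply/SU; rewrite Uf memvf.
Qed.

(** A subspace containing all brackets is an ideal, and it is nonzero because the bracket is. *)
Lemma simple_perfect (S : L -> Prop) : simple_lie br ->
  S 0 -> (forall a u v, S u -> S v -> S (a *: u + v)) ->
  (forall x y, S (br x y)) -> forall x, S x.
Proof.
move=> simpL S0 SD Sbr; apply: simple_ideal => //.
by case: simpL => _ [x [y nz]] _; exists (br x y).
Qed.

Notation D := (\dim {:L}).

Definition lie_basis (i : 'I_D) : L := (vbasis {:L})`_i.
Definition lie_coord (x : L) : 'rV[F]_D := \row_i coord (vbasis {:L}) i x.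
(* Row vectors carry the right action [z |-> br z y], which makes this a representation. *)
Definition adjoint_mx (y : L) : 'M[F]_D := \matrix_i lie_coord (br (lie_basis i) y).

Lemma lie_coordP a x y : lie_coord (a *: x + y) = a *: lie_coord x + lie_coord y.
Proof. by apply/rowP => i; rewrite !mxE linearP. Qed.

Lemma lie_coordE x : x = \sum_i lie_coord x 0 i *: lie_basis i.
Proof.
rewrite {1}(coord_vbasis (memvf x)).
by apply: eq_bigr => i _; rewrite mxE.
Qed.

Lemma lie_coordK (v : 'rV[F]_D) : lie_coord (\sum_i v 0 i *: lie_basis i) = v.
Proof.
apply/rowP => i; rewrite mxE linear_sum (bigD1 i) //= linearZ /=.
have fr := basis_free (vbasisP {:L}).
rewrite /lie_basis (coord_free _ _ fr) eqxx mulr1 big1 ?addr0 // => j neji.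
by rewrite linearZ /= (coord_free _ _ fr) (negPf neji) mulr0.
Qed.

Lemma lie_coord_inj : injective lie_coord.
Proof. by move=> x y e; rewrite (lie_coordE x) (lie_coordE y) e. Qed.

Lemma lie_coord_br x y : lie_coord (br x y) = lie_coord x *m adjoint_mx y.
Proof.
rewrite {1}(lie_coordE x) (lin_sum (brl _)) (lin_sum lie_coordP) mulmx_sum_row.
by apply: eq_bigr => i _; rewrite rowK (linZ (brl _)) (linZ lie_coordP).
Qed.

Lemma adjoint_ext (A B : 'M[F]_D) :
  (forall x, lie_coord x *m A = lie_coord x *m B) -> A = B.
Proof.
move=> AB; apply/row_matrixP => i; rewrite !rowE.
by rewrite -(lie_coordK (delta_mx 0 i)) AB.
Qed.

Lemma adjoint_rep : lie_rep br adjoint_mx.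
Proof.
split=> [a x y|x y]; apply: adjoint_ext => z.
  by rewrite mulmxDr -scalemxAr -!lie_coord_br brr lie_coordP.
rewrite mulmxBr !mulmxA -!lie_coord_br br_jacobi.
by rewrite (linD lie_coordP) (linN lie_coordP).
Qed.

End LieAlgebra.

(** * Invariant trace forms *)

Section TraceForm.
Variables (F : numClosedFieldType) (L : vectType F) (br : L -> L -> L).
Hypothesis lieL : lie_algebra br.
Variables (d : nat) (rho : L -> 'M[F]_d).
Hypothesis rep : lie_rep br rho.

Definition trace_form x y := \tr (rho x *m rho y).

Lemma trace_formC x y : trace_form x y = trace_form y x.
Proof. exact: mxtrace_mulC. Qed.

Lemma trace_form_lin y a x1 x2 :
  trace_form (a *: x1 + x2) y = a * trace_form x1 y + trace_form x2 y.
Proof.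
by case: rep => lin _; rewrite /trace_form lin mulmxDl -scalemxAl mxtraceD mxtraceZ.
Qed.

Lemma trace_form_inv x y z : trace_form (br x z) y = trace_form x (br z y).
Proof.
case: rep => _ rbr; rewrite /trace_form !rbr mulmxBl mulmxBr !raddfB /= -!mulmxA.
by rewrite [\tr (rho z *m _)]mxtrace_mulC -!mulmxA.
Qed.

Lemma sl2_trace_form_eq0 e h f :
  br h e = 2 *: e -> br h f = - 2 *: f -> br e f = h ->
  trace_form h h = 0 -> rho e = 0.
Proof.
case: rep => lin rbr he hf ef; apply: (@sl2_trace_sqr_eq0 _ _ _ _ (rho f)).
- by rewrite -rbr he (linZ lin).
- by rewrite -rbr hf (linZ lin).
- by rewrite -rbr ef.
Qed.

(** The radical is an ideal. If it were nonzero it would be everything, so [trace_form rho h h = 0]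
    and [rho e = 0]; then the kernel of [rho] would be a nonzero ideal, making [rho] zero. *)
Lemma trace_form_nondeg e h f : simple_lie br ->
  br h e = 2 *: e -> br h f = - 2 *: f -> br e f = h -> e != 0 ->
  (exists x, rho x != 0) ->
  forall x, (forall y, trace_form x y = 0) -> x = 0.
Proof.
case: rep => lin rbr simpL he hf ef e0 [x0 /eqP rx0] x Bx.
apply/eqP/negPn/negP => xn0; case: rx0.
suff re0 : rho e = 0.
  apply: (@simple_ideal _ _ br (fun x => rho x = 0) simpL).
  - exact: lin0.
  - by move=> a u v ru rv; rewrite lin ru rv scaler0 addr0.
  - by move=> u v rv; rewrite rbr rv mulmx0 mul0mx subr0.
  - by exists e.
apply: (sl2_trace_form_eq0 he hf ef).
suff : forall z y, trace_form z y = 0 by apply.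
apply: (@simple_ideal _ _ br _ simpL).
- by move=> y; rewrite /trace_form lin0 // mul0mx mxtrace0.
- by move=> a u v Bu Bv y; rewrite trace_form_lin Bu Bv mulr0 addr0.
- move=> u v Bv y; rewrite br_anti // -scaleN1r -[_ *: _]addr0 trace_form_lin.
  by rewrite trace_form_inv Bv mulr0 /trace_form lin0 // mul0mx mxtrace0 addr0.
- by exists x.
Qed.

End TraceForm.

(** * The Casimir element of a trace form *)

Section Casimir.
Variables (F : numClosedFieldType) (L : vectType F) (br : L -> L -> L).
Hypothesis lieL : lie_algebra br.
Notation D := (\dim {:L}).

Definition gram_mx d (q : L -> 'M[F]_d) : 'M[F]_D :=
  \matrix_(i, j) trace_form q (lie_basis i) (lie_basis j).

(** With [H] the inverse Gram matrix of a trace form, this is the image under [rho] of its Casimir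
    element. Keeping [H] separate allows the form to come from a subquotient while the element acts
    on the whole module. *)
Definition casimir (H : 'M[F]_D) d (rho : L -> 'M[F]_d) : 'M[F]_d :=
  \sum_i \sum_j H i j *: (rho (lie_basis i) *m rho (lie_basis j)).

Lemma gram_unit d (q : L -> 'M[F]_d) : lie_rep br q ->
  (forall x, (forall y, trace_form q x y = 0) -> x = 0) -> gram_mx q \in unitmx.
Proof.
move=> rep nd; rewrite -row_free_unit -kermx_eq0; apply/eqP/row_matrixP => i.
rewrite row0; set v := row i _.
have vG : v *m gram_mx q = 0 by rewrite -row_mul mulmx_ker row0.
rewrite -(lie_coordK v) (nd (\sum_i _)) ?(lin0 (@lie_coordP _ _)) //.
move=> y; rewrite trace_formC (lie_coordE y) /trace_form.
case: (rep) => lin _; rewrite !(lin_sum lin) mulmx_suml raddf_sum big1 //= => j _.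
move/rowP: vG => /(_ j); rewrite !mxE => vG.
rewrite (linZ lin) -scalemxAl mxtraceZ mulmx_sumr raddf_sum /=.
rewrite (eq_bigr (fun k => v 0 k * gram_mx q k j)) ?vG ?mulr0 // => k _.
by rewrite (linZ lin) -scalemxAr mxtraceZ mxtrace_mulC [gram_mx _ _ _]mxE.
Qed.

Lemma rep_adjoint d (rho : L -> 'M[F]_d) y i : lie_rep br rho ->
  rho (br (lie_basis i) y) = \sum_k adjoint_mx br y i k *: rho (lie_basis k).
Proof.
case=> lin _; rewrite {1}(lie_coordE (br _ y)) (lin_sum lin).
by apply: eq_bigr => k _; rewrite (linZ lin) [adjoint_mx _ _ _ _]mxE.
Qed.

Lemma gram_adjoint d (q : L -> 'M[F]_d) y : lie_rep br q ->
  adjoint_mx br y *m gram_mx q = - (gram_mx q *m (adjoint_mx br y)^T).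
Proof.
move=> rep; apply/matrixP => i j; rewrite [LHS]mxE [RHS]mxE [(gram_mx q *m _) i j]mxE.
transitivity (trace_form q (br (lie_basis i) y) (lie_basis j)).
  rewrite /trace_form rep_adjoint // mulmx_suml raddf_sum /=.
  by apply: eq_bigr => k _; rewrite -scalemxAl mxtraceZ [gram_mx _ _ _]mxE.
rewrite (trace_form_inv rep) br_anti // /trace_form.
case: (rep) => lin _; rewrite (linN lin) mulmxN raddfN /=; congr (- _).
rewrite rep_adjoint // mulmx_sumr raddf_sum /=.
apply: eq_bigr => k _; rewrite -scalemxAr mxtraceZ [gram_mx _ _ _]mxE mulrC.
by rewrite [_^T _ _]mxE.
Qed.

(** With [H] the inverse Gram matrix and [Y] the matrix of [y] in the adjoint representation, the
    commutator with [rho y] has coefficient matrix [H Y + Y^T H]; invariance of the form makes it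
    zero. *)
Lemma casimir_comm d r (q : L -> 'M[F]_r) (rho : L -> 'M[F]_d) y :
  lie_rep br q -> lie_rep br rho -> gram_mx q \in unitmx ->
  casimir (invmx (gram_mx q)) rho *m rho y = rho y *m casimir (invmx (gram_mx q)) rho.
Proof.
move=> repq rep uG; set H := invmx _; set Y := adjoint_mx br y.
have HY : H *m Y = - (Y^T *m H).
  have := gram_adjoint y repq => /(congr1 (fun X => H *m X *m H)).
  rewrite mulmxN mulNmx !mulmxA mulVmx // mul1mx -/Y => <-.
  by rewrite -!mulmxA mulmxV // mulmx1.
apply/eqP; rewrite -subr_eq0; apply/eqP.
have -> : casimir H rho *m rho y - rho y *m casimir H rho =
   \sum_i \sum_j H i j *: (rho (lie_basis i) *m rho (br (lie_basis j) y))
   + \sum_i \sum_j H i j *: (rho (br (lie_basis i) y) *m rho (lie_basis j)).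
  rewrite mulmx_suml mulmx_sumr -sumrB -big_split; apply: eq_bigr => i _ /=.
  rewrite mulmx_suml mulmx_sumr -sumrB -big_split; apply: eq_bigr => j _ /=.
  case: (rep) => _ rbr; rewrite -scalemxAl -scalemxAr -scalerBr -scalerDr; congr (_ *: _).
  by rewrite !rbr mulmxBr mulmxBl !mulmxA addrA subrK.
have -> : \sum_i \sum_j H i j *: (rho (lie_basis i) *m rho (br (lie_basis j) y)) =
   casimir (H *m Y) rho.
  apply: eq_bigr => i _.
  transitivity (\sum_j \sum_k (H i j * Y j k) *: (rho (lie_basis i) *m rho (lie_basis k))).
    apply: eq_bigr => j _; rewrite rep_adjoint // mulmx_sumr scaler_sumr.
    by apply: eq_bigr => k _; rewrite -scalemxAr scalerA.
  by rewrite exchange_big; apply: eq_bigr => k _; rewrite mxE scaler_suml.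
have -> : \sum_i \sum_j H i j *: (rho (br (lie_basis i) y) *m rho (lie_basis j)) =
   casimir (Y^T *m H) rho.
  transitivity (\sum_i \sum_j \sum_k (H i j * Y i k) *: (rho (lie_basis k) *m rho (lie_basis j))).
    apply: eq_bigr => i _; apply: eq_bigr => j _; rewrite rep_adjoint // mulmx_suml scaler_sumr.
    by apply: eq_bigr => k _; rewrite -scalemxAl scalerA.
  under eq_bigr => i _ do rewrite exchange_big /=.
  rewrite exchange_big /=; apply: eq_bigr => k _; rewrite exchange_big /=.
  apply: eq_bigr => j _; rewrite mxE scaler_suml.
  by apply: eq_bigr => i _; rewrite [Y^T k i]mxE mulrC.
rewrite /casimir -big_split big1 // => i _; rewrite -big_split big1 // => j _ /=.
by rewrite HY mxE scaleNr addNr.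
Qed.

Lemma trace_casimir d (q : L -> 'M[F]_d) : gram_mx q \in unitmx ->
  \tr (casimir (invmx (gram_mx q)) q) = D%:R.
Proof.
move=> uG; rewrite -mxtrace1 -(mulVmx uG) /casimir /mxtrace -/(mxtrace _) raddf_sum.
apply: eq_bigr => i _; rewrite raddf_sum mxE; apply: eq_bigr => j _ /=.
by rewrite mxtraceZ [gram_mx q _ _]mxE trace_formC.
Qed.

End Casimir.

Lemma quot_rep (F : fieldType) (L : vectType F) (br : L -> L -> L) d r
    (rho : L -> 'M[F]_d) (N1 N2 : 'M[F]_d) (K : 'M[F]_(r, d)) C :
  lie_rep br rho -> (forall x, stablemx N1 (rho x)) -> (forall x, stablemx N2 (rho x)) ->
  quot_basis N1 N2 K C -> lie_rep br (fun x => K *m rho x *m C).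
Proof.
case=> lin rbr s1 s2 qb; split=> [a x y|x y].
  by rewrite lin mulmxDr mulmxDl -scalemxAr -scalemxAl.
by rewrite !(quot_mulmx qb) // rbr mulmxBr mulmxBl.
Qed.

(** * Whitehead's lemma *)

Section Weyl.
Variables (F : numClosedFieldType) (L : vectType F) (br : L -> L -> L).
Hypothesis simpL : simple_lie br.
Variables e h f : L.
Hypothesis (he : br h e = 2 *: e) (hf : br h f = - 2 *: f) (ef : br e f = h).
Hypothesis e0 : e != 0.

Let lieL : lie_algebra br. Proof. by case: simpL. Qed.

Section IrreducibleStep.
Variables (d : nat) (rho : L -> 'M[F]_d) (N1 N2 : 'M[F]_d).
Hypothesis rep : lie_rep br rho.
Hypothesis le12 : (N1 <= N2)%MS.
Hypothesis s1 : forall x, stablemx N1 (rho x).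
Hypothesis s2 : forall x, stablemx N2 (rho x).
Hypothesis irr : forall N : 'M[F]_d, (forall x, stablemx N (rho x)) ->
  (N1 <= N)%MS -> (N <= N2)%MS -> (N <= N1)%MS \/ (N2 <= N)%MS.

(** If [L] acts trivially on [N2 / N1], the cocycle of [m] vanishes on brackets, hence everywhere.
    Otherwise the Casimir element [c] of the trace form of [N2 / N1] is invertible there, and [n] is
    chosen with [n c = m c] modulo [N1]; since [c] commutes with [rho], it carries [(m - n) rho x]
    into [N1], so that vector is already in [N1]. *)
Lemma whitehead_irreducible (m : 'rV[F]_d) : (forall x, m *m rho x <= N2)%MS ->
  exists2 n : 'rV[F]_d, (n <= N2)%MS & forall x, ((m - n) *m rho x <= N1)%MS.
Proof.
move=> mN2; have [r [K [C qb]]] := quot_basis_exists le12.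
pose q x := K *m rho x *m C; have repq : lie_rep br q := quot_rep rep s1 s2 qb.
have [KC N1C KN2 sub] := qb; have [lin rbr] := rep.
have [q0|nq] := classic (forall x, q x = 0).
  exists 0 => [|x]; rewrite ?sub0mx // subr0; move: x.
  have N2N1 x (v : 'rV_d) : (v <= N2)%MS -> (v *m rho x <= N1)%MS.
    move=> vN2; have KN1 : (K *m rho x <= N1)%MS.
      apply: (sub_quot0 qb); last exact: q0.
      by apply: submx_trans (s2 x); apply: submxMr.
    have := sub _ _ vN2; move/(submxMr (rho x)); rewrite mulmxBl => H.
    rewrite -[v *m rho x](subrK (v *m C *m K *m rho x)) addmx_sub //.
      exact: submx_trans H (s1 x).
    by rewrite -mulmxA; apply: mulmx_sub.
  apply: (simple_perfect simpL).
  - by rewrite (lin0 lin) mulmx0 sub0mx.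
  - by move=> a u v Hu Hv; rewrite lin mulmxDr -scalemxAr addmx_sub // scalemx_sub.
  - by move=> x y; rewrite rbr mulmxBr !mulmxA addmx_sub ?eqmx_opp // N2N1.
have nzq : exists x, q x != 0.
  by apply: NNPP => nx; apply: nq => x; apply/eqP/negPn/negP => qx; apply: nx; exists x.
have nd := trace_form_nondeg lieL repq simpL he hf ef e0 nzq.
have uG := gram_unit repq nd.
set H := invmx (gram_mx q); pose c := casimir H rho.
have cC x : c *m rho x = rho x *m c by apply: casimir_comm repq rep uG.
have qc : K *m c *m C = casimir H q.
  rewrite /c /casimir mulmx_sumr mulmx_suml; apply: eq_bigr => i _.
  rewrite mulmx_sumr mulmx_suml; apply: eq_bigr => j _.
  by rewrite -scalemxAr -scalemxAl (quot_mulmx qb).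
(* The vector [m] itself may lie outside [N2], but [m *m c] is inside, since each term of [c] starts
   with some [rho x]. *)
have N2c p (A : 'M[F]_(p, d)) : (forall x, A *m rho x <= N2)%MS -> (A *m c <= N2)%MS.
  move=> AN2; rewrite /c /casimir mulmx_sumr summx_sub // => i _.
  rewrite mulmx_sumr summx_sub // => j _; rewrite -scalemxAr scalemx_sub // mulmxA.
  by apply: submx_trans (s2 (lie_basis j)); apply: submxMr.
have N2c' p (A : 'M[F]_(p, d)) : (A <= N2)%MS -> (A *m c <= N2)%MS.
  by move=> AN2; apply: N2c => x; apply: submx_trans (s2 x); apply: submxMr.
have N1c (v : 'rV_d) : (v <= N1)%MS -> (v *m c <= N1)%MS.
  move=> vN1; rewrite /c /casimir mulmx_sumr summx_sub // => i _.
  rewrite mulmx_sumr summx_sub // => j _; rewrite -scalemxAr scalemx_sub // mulmxA.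
  apply: submx_trans (s1 (lie_basis j)); apply: submxMr.
  by apply: submx_trans (s1 (lie_basis i)); apply: submxMr.
(* [N] is the kernel of [c] on [N2] modulo [N1], a submodule because [c] is central. By
   irreducibility it is [N1] or [N2]; the latter would make the trace of [c] on the quotient zero,
   while it equals the dimension of [L]. *)
have [||N SN] := @mx_of_pred F d (fun v => (v <= N2)%MS /\ (v *m c <= N1)%MS).
- by rewrite mul0mx !sub0mx.
- move=> a u v [u1 u2] [v1 v2]; rewrite mulmxDl -scalemxAl.
  by rewrite !addmx_sub // scalemx_sub.
have cinj (v : 'rV_d) : (v <= N2)%MS -> (v *m c <= N1)%MS -> (v <= N1)%MS.
  case: (irr (N := N)).
  - move=> x; apply/row_subP => i; rewrite row_mul.
    have /SN [r1 r2] := row_sub i N; apply/SN; split.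
      by apply: submx_trans (s2 x); apply: submxMr.
    by rewrite -mulmxA -cC mulmxA; apply: submx_trans (s1 x); apply: submxMr.
  - apply/row_subP => i; have r1 := row_sub i N1; apply/SN; split; last exact: N1c.
    exact: submx_trans r1 le12.
  - by apply/row_subP => i; have /SN [] := row_sub i N.
  - by move=> NN1 v1 v2; apply: submx_trans NN1; apply/SN.
  move=> N2N; exfalso.
  have : K *m c *m C = 0.
    apply: (quot0_sub qb); apply/row_subP => i; rewrite row_mul.
    have /SN [] // : (row i K <= N)%MS.
    exact: submx_trans (row_sub i K) (submx_trans KN2 N2N).
  move/(congr1 (@mxtrace _ _)); rewrite mxtrace0 qc trace_casimir // => /eqP.
  rewrite pnatr_eq0 dimv_eq0 => /eqP L0.
  by have := memvf e; rewrite L0 memv0 (negPf e0).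
have uc : K *m c *m C \in unitmx.
  rewrite -row_free_unit -kermx_eq0; apply/eqP/row_matrixP => i; rewrite row0.
  set w := row i _.
  have wK : w *m (K *m c *m C) = 0 by rewrite -row_mul mulmx_ker row0.
  have wKN2 : (w *m K <= N2)%MS by apply: mulmx_sub.
  have wKN1 : (w *m K <= N1)%MS.
    apply: cinj => //; apply: (sub_quot0 qb); first exact: N2c'.
    by rewrite -!mulmxA mulmxA in wK *.
  by rewrite -[w]mulmx1 -KC mulmxA (quot0_sub qb wKN1).
exists (m *m c *m C *m invmx (K *m c *m C) *m K); first exact: mulmx_sub.
set n := _ *m K; have nN2 : (n <= N2)%MS by apply: mulmx_sub.
move=> x; apply: cinj.
  by rewrite mulmxBl addmx_sub ?eqmx_opp ?mN2 //; apply: submx_trans (s2 x); apply: submxMr.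
rewrite -mulmxA -cC mulmxA; apply: submx_trans (s1 x); apply: submxMr.
apply: (sub_quot0 qb).
  by rewrite mulmxBl; apply: addmx_sub; rewrite ?eqmx_opp; [apply: N2c|apply: N2c'].
by rewrite !mulmxBl /n -(mulmxA _ K c) -(mulmxA _ (K *m c) C) mulmxKV // subrr.
Qed.

End IrreducibleStep.

(* Vanishing of the first cohomology of [N2 / N1], for a cocycle that becomes
   the coboundary of [m] in the ambient module. *)
Lemma whitehead d (rho : L -> 'M[F]_d) (N1 N2 : 'M[F]_d) (m : 'rV[F]_d) :
  lie_rep br rho -> (N1 <= N2)%MS ->
  (forall x, stablemx N1 (rho x)) -> (forall x, stablemx N2 (rho x)) ->
  (forall x, m *m rho x <= N2)%MS ->
  exists2 n : 'rV[F]_d, (n <= N2)%MS & forall x, ((m - n) *m rho x <= N1)%MS.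
Proof.
move=> rep; have [k] := ubnP (\rank N2 - \rank N1).
elim: k N1 N2 m => // k IH N1 N2 m; rewrite ltnS => rk le12 s1 s2 mN2.
pose between (N : 'M[F]_d) := [/\ forall x, stablemx N (rho x), (N1 <= N)%MS, (N <= N2)%MS,
                      ~~ (N <= N1)%MS & ~~ (N2 <= N)%MS].
have [[N [sN le1 le2 n1 n2]]|irr] := classic (exists N, between N); last first.
  apply: whitehead_irreducible => // N sN le1 le2.
  case: (boolP (N <= N1)%MS) => [|n1]; first by left.
  case: (boolP (N2 <= N)%MS) => [|n2]; first by right.
  by case: irr; exists N.
have lt1 : (\rank N1 < \rank N)%N by apply: rank_ltmx; rewrite /ltmx le1.
have lt2 : (\rank N < \rank N2)%N by apply: rank_ltmx; rewrite /ltmx le2.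
(* Solve first in [N2 / N], then correct the remainder in [N / N1]; the two solutions add up. *)
have [|n nN2 Hn] := IH N N2 m _ le2 sN s2 mN2.
  by apply: leq_trans rk; apply: ltn_sub2l => //; apply: ltn_trans lt1 lt2.
have [|n' n'N Hn'] := IH N1 N (m - n) _ le1 s1 sN Hn.
  by apply: leq_trans rk; apply: ltn_sub2r => //; apply: ltn_trans lt1 lt2.
exists (n + n'); first by rewrite addmx_sub // (submx_trans n'N).
by move=> x; rewrite opprD addrA.
Qed.

End Weyl.

(** * Nonvanishing of polynomials and matrix pencils *)

Section Polynomials.
Variable F : numFieldType.

Lemma poly_natr_nonroot (p : {poly F}) : p != 0 -> exists n : nat, p.[n%:R] != 0.
Proof.
move=> p0; apply: NNPP => np.
have rp n : root p n%:R by apply/eqP; apply: NNPP => /eqP pn; apply: np; exists n.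
have := @max_poly_roots _ p (map (fun i => i%:R) (iota 0 (size p))) p0.
rewrite size_map size_iota ltnn map_inj_uniq ?iota_uniq; last first.
  by move=> i j /eqP; rewrite eqr_nat => /eqP.
by move=> H; suff: false by []; apply: H => //; apply/allP => x /mapP [i _ ->].
Qed.

(** For [A] invertible, [p] is the determinant of the pencil, nonzero at 0. For [B] invertible, [p]
    is the characteristic polynomial of [- A B^-1], which is monic. *)
Lemma pencil_unit n (A B : 'M[F]_n) : A \in unitmx \/ B \in unitmx ->
  exists2 p : {poly F}, p != 0 & forall t, p.[t] != 0 -> A + t *: B \in unitmx.
Proof.
case=> u; last first.
  exists (char_poly (- (A *m invmx B))) => [|t].
    by rewrite -size_poly_eq0 size_char_poly.
  rewrite -rootE -eigenvalue_root_char /eigenvalue /eigenspace negbK kermx_eq0.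
  rewrite row_free_unit => uABt.
  have -> : A + t *: B = - ((- (A *m invmx B) - t%:M) *m B).
    by rewrite mulmxBl mulNmx mulmxKV // mul_scalar_mx opprB opprK addrC.
  by rewrite -scaleN1r unitmxZ ?unitrN1 // unitmx_mul uABt u.
exists (\det (map_mx polyC A + 'X *: map_mx polyC B)) => [|t].
  apply: contraTneq u => /(congr1 (horner_eval 0)); rewrite rmorph0 -det_map_mx.
  rewrite unitmxE unitfE => det0; rewrite negbK; apply/eqP; rewrite -[RHS]det0.
  congr (\det _); apply/matrixP => i j.
  by rewrite !mxE /= horner_evalE !hornerE.
rewrite -horner_evalE -det_map_mx unitmxE unitfE.
congr (\det _ != 0); apply/matrixP => i j.
by rewrite !mxE /= horner_evalE !hornerE.
Qed.

End Polynomials.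

(** * Nilpotent subalgebras and a regular element of a Cartan subalgebra *)

Section Engel.
Variables (F : numClosedFieldType) (L : vectType F) (br : L -> L -> L).
Hypothesis lieL : lie_algebra br.
Variable h : {vspace L}.
Hypothesis subh : subalgebra br h.
Hypothesis nilh : nilpotent_subalgebra br h.

Let brr x : forall a y1 y2, br x (a *: y1 + y2) = a *: br x y1 + br x y2.
Proof. by case: lieL => _ + _ _; apply. Qed.

Lemma nilpotent_foldr : exists k, forall xs y, size xs = k ->
  {in xs, forall x, x \in h} -> y \in h -> foldr br y xs = 0.
Proof.
case: nilh => k nk; exists k => xs y sxs xsh yh.
have := nk (fun i => xs`_i) y; rewrite -foldr_map.
have -> : [seq xs`_(nat_of_ord i) | i <- enum 'I_k] = xs.
  rewrite (map_comp (nth 0 xs) (@nat_of_ord k)) val_enum_ord -sxs.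
  exact: mkseq_nth.
by apply=> // i; apply: xsh; rewrite mem_nth // sxs.
Qed.

(** If every element of [h] outside [a] could be bracketed by [h] to another one outside [a],
    iterating from [z] would give nonzero brackets of every length. *)
Lemma nilpotent_next (a : {vspace L}) z : z \in h -> z \notin a ->
  exists y, [/\ y \in h, y \notin a & forall x, x \in h -> br x y \in a].
Proof.
move=> zh za; apply: NNPP => ny; have [k nk] := nilpotent_foldr.
have : exists xs, [/\ size xs = k, {in xs, forall x, x \in h}, foldr br z xs \in h
                    & foldr br z xs \notin a].
  elim: k {nk} => [|k [xs [sxs xsh yh ya]]]; first by exists [::].
  apply: NNPP => nxs; apply: ny; exists (foldr br z xs); split=> // x xh.
  apply/negPn/negP => xa; apply: nxs; exists (x :: xs); split=> //=.
  - by rewrite sxs.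
  - by move=> u; rewrite inE => /orP [/eqP ->|/xsh].
  - exact: subh.
by case=> xs [sxs xsh _]; rewrite nk // mem0v.
Qed.

Section Rep.
Variables (d : nat) (rho : L -> 'M[F]_d).
Hypothesis lin : forall a x y, rho (a *: x + y) = a *: rho x + rho y.
Hypothesis rbr : forall x y, x \in h -> y \in h ->
  rho (br x y) = rho x *m rho y - rho y *m rho x.

(** The subspace [a] grows through ideals of [h] that have a common null vector. The common null
    space of [a] is stable under a next element [y], which is nilpotent there, so the last nonzero
    [v y^i] is also killed by [y]. *)
Lemma engel : (0 < d)%N ->
  (forall y, y \in h -> forall v : 'rV[F]_d, exists R, v *m rho y ^+ R = 0) ->
  exists2 v : 'rV[F]_d, v != 0 & forall y, y \in h -> v *m rho y = 0.
Proof.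
move=> d0 nilp.
suff step : forall k (a : {vspace L}), (\dim h - \dim a < k)%N -> (a <= h)%VS ->
    (forall x y, x \in h -> y \in a -> br x y \in a) ->
    (exists2 v : 'rV[F]_d, v != 0 & forall y, y \in a -> v *m rho y = 0) ->
    exists2 v : 'rV[F]_d, v != 0 & forall y, y \in h -> v *m rho y = 0.
  apply: (step _ 0%VS (ltnSn _)).
  - exact: sub0v.
  - by move=> x y _; rewrite !memv0 => /eqP ->; rewrite (lin0 (brr x)).
  exists (delta_mx 0 (Ordinal d0)) => [|y].
    by apply/eqP => /rowP /(_ (Ordinal d0)) /eqP; rewrite !mxE !eqxx oner_eq0.
  by rewrite memv0 => /eqP ->; rewrite (lin0 lin) mulmx0.
elim=> // k IH a; rewrite ltnS => dk ah ida [v v0 va].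
have [ha|/subvPn [z zh za]] := boolP (h <= a)%VS.
  by exists v => // y /(subvP ha) /va.
have [y [yh ya yid]] := nilpotent_next zh za.
have stab u t : (forall t, t \in a -> u *m rho t = 0) -> t \in a -> u *m rho y *m rho t = 0.
  move=> ua ta; have := rbr yh (subvP ah _ ta).
  move/(congr1 (mulmx u)); rewrite mulmxBr !mulmxA (ua _ (ida _ _ yh ta)) (ua _ ta) mul0mx subr0.
  by move=> <-.
have [i [wn0 w1]] : exists i, v *m rho y ^+ i != 0 /\ v *m rho y ^+ i.+1 = 0.
  apply: (first_vanishing (v := fun i => v *m rho y ^+ i)); first by rewrite expr0 mulmx1.
  exact: nilp.
have wa t : t \in a -> v *m rho y ^+ i *m rho t = 0.
  elim: i {wn0 w1} t => [|i IHi] t ta; first by rewrite expr0 mulmx1 va.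
  by rewrite exprSr -mulmxE mulmxA stab.
apply: (IH (a + <[y]>)%VS).
- have lta : (\dim a < \dim (a + <[y]>))%N.
    rewrite (ltn_leqif (dimv_leqif_sup (addvSl _ _))).
    apply: contra ya => /subvP -> //.
    by rewrite (subvP (addvSr _ _)) ?memv_line.
  have leh : (\dim (a + <[y]>) <= \dim h)%N.
    by apply: dimvS; rewrite subv_add ah -memvE.
  by apply: leq_trans dk; apply: ltn_sub2l => //; apply: leq_trans leh.
- by rewrite subv_add ah -memvE.
- move=> x t xh /memv_addP [u ua [u' /vlineP [c ->] ->]].
  rewrite addrC brr; apply: (subvP (addvSl a <[y]>)).
  by apply: memvD; [apply/memvZ/yid|apply: ida].
- exists (v *m rho y ^+ i) => // t /memv_addP [u ua [u' /vlineP [c ->] ->]].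
  by rewrite addrC lin mulmxDr -scalemxAr wa // -mulmxA mulmxE -exprSr w1 scaler0 addr0.
Qed.

(** From [v y y0 = v y0 y - v [y0, y]]: the first term needs a smaller power of [y0] to kill its
    vector, the second has one more bracket with [y0], and long iterated brackets vanish. Hence the
    double induction, on the brackets left and on that power. *)
Lemma fitting_null_stable y0 : y0 \in h -> forall y (v : 'rV[F]_d), y \in h ->
  (exists R, v *m rho y0 ^+ R = 0) -> exists R, (v *m rho y) *m rho y0 ^+ R = 0.
Proof.
move=> y0h; have [k nk] := nilpotent_foldr.
have iterh y i : y \in h -> iter i (br y0) y \in h.
  by move=> yh; elim: i => //= i; apply: subh.
suff H : forall j i y (v : 'rV[F]_d), (k - i <= j)%N -> y \in h ->
    (exists R, v *m rho y0 ^+ R = 0) ->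
    exists R, (v *m rho (iter i (br y0) y)) *m rho y0 ^+ R = 0.
  by move=> y v yh vR; apply: (H _ 0%N y v (leqnn _)).
have fin i y : (k <= i)%N -> y \in h -> iter i (br y0) y = 0.
  move=> /subnK <- yh; rewrite iterD.
  have -> : iter k (br y0) y = 0.
    rewrite -(nk (nseq k y0) y) ?size_nseq //; last by move=> x /nseqP [->].
    by elim: k {nk} => //= k ->.
  by elim: (i - k)%N => //= j ->; rewrite (lin0 (brr y0)).
elim=> [|j IHj] i y v.
  rewrite leqn0 subn_eq0 => ki yh _; exists 0%N.
  by rewrite fin // (lin0 lin) mulmx0 mul0mx.
move=> kij yh [R]; elim: R v => [|R IHR] v.
  by rewrite expr0 mulmx1 => ->; exists 0%N; rewrite !mul0mx.
rewrite exprS -mulmxE mulmxA => vR.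
have [R1 H1] := IHR _ vR.
have [||R2 H2] := IHj i.+1 y v _ yh.
- by rewrite subnS; case: (k - i)%N kij.
- by exists R.+1; rewrite exprS -mulmxE mulmxA.
exists (R1 + R2).+1.
rewrite exprS -mulmxE mulmxA.
have -> : v *m rho (iter i (br y0) y) *m rho y0 =
  v *m rho y0 *m rho (iter i (br y0) y) - v *m rho (iter i.+1 (br y0) y).
  by rewrite /= rbr ?iterh // mulmxBr !mulmxA opprB addrC subrK.
rewrite mulmxBl {1}exprD addnC exprD -!mulmxE !mulmxA.
rewrite H1 mul0mx.
by rewrite H2 mul0mx subr0.
Qed.

End Rep.

(** If all of [h] acts nilpotently, Engel's theorem gives [v]. Otherwise the Fitting null space [N]
    of some [y0] is a proper submodule with [y0] invertible on the quotient, and induction applies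
    to [N]. *)
Lemma nilpotent_dichotomy d (rho : L -> 'M[F]_d) :
  (forall a x y, rho (a *: x + y) = a *: rho x + rho y) ->
  (forall x y, x \in h -> y \in h -> rho (br x y) = rho x *m rho y - rho y *m rho x) ->
  (exists2 y, y \in h & rho y \in unitmx) \/
  (exists2 v : 'rV[F]_d, v != 0 & forall y, y \in h -> v *m rho y = 0).
Proof.
have [k] := ubnP d; elim: k d rho => // k IH d rho; rewrite ltnS => dk lin rbr.
pose lnil y := forall v : 'rV[F]_d, exists R, v *m rho y ^+ R = 0.
have [[y0 [y0h ny0]]|alln] := classic (exists y, y \in h /\ ~ lnil y); last first.
  case: (posnP d) => [d0|dpos].
    left; exists 0; rewrite ?mem0v // unitmxE; move: (rho 0); rewrite d0 => A.
    by rewrite det_mx00 unitr1.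
  right; apply: engel => // y yh; apply: NNPP => ny; apply: alln; by exists y.
have [||N SN] := @mx_of_pred F d (fun v => exists R, v *m rho y0 ^+ R = 0).
- by exists 0%N; rewrite mul0mx.
- move=> a u v [R1 H1] [R2 H2]; exists (R1 + R2)%N.
  rewrite mulmxDl -scalemxAl {1}exprD addnC exprD -!mulmxE !mulmxA.
  by rewrite H1 H2 !mul0mx scaler0 addr0.
have sN y : y \in h -> stablemx N (rho y).
  move=> yh; apply/row_subP => i; rewrite row_mul; apply/SN.
  by apply: fitting_null_stable => //; apply/SN/row_sub.
have Nlt : (\rank N < d)%N.
  rewrite ltn_neqAle rank_leq_row andbT; apply/negP => fN; apply: ny0 => v.
  by apply/SN/submx_full.
have [r1 [K1 [C1 q1]]] := quot_basis_exists (sub0mx d N).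
have [r2 [K2 [C2 q2]]] := quot_basis_exists (submx1 N).
have [K1C1 _ K1N sub1] := q1; have [K2C2 _ _ sub2] := q2.
have r1k : (r1 < k)%N.
  apply: leq_trans dk; apply: leq_trans Nlt; rewrite ltnS.
  apply: leq_trans (mxrankS K1N); rewrite row_leq_rank.
  by apply/row_freeP; exists C1.
have s0 y : stablemx (0 : 'M[F]_d) (rho y) by rewrite mul0mx sub0mx.
have [|x y xh yh|[y1 y1h u1]|[v v0 vn]] := IH r1 (fun y => K1 *m rho y *m C1) r1k.
- by move=> a x y; rewrite lin mulmxDr mulmxDl -scalemxAr -scalemxAl.
- rewrite !(quot_mulmx q1) ?sN //.
  by rewrite rbr // mulmxBr mulmxBl.
- have u2 : K2 *m rho y0 *m C2 \in unitmx.
    rewrite -row_free_unit -kermx_eq0; apply/eqP/row_matrixP => i; rewrite row0.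
    set w := row i _.
    have wK : w *m (K2 *m rho y0 *m C2) = 0 by rewrite -row_mul mulmx_ker row0.
    have wN : (w *m K2 *m rho y0 <= N)%MS.
      by apply: (sub_quot0 q2); rewrite ?submx1 // -!mulmxA mulmxA in wK *.
    have {}wN : (w *m K2 <= N)%MS.
      apply/SN; case/SN: wN => R HR; exists R.+1.
      by rewrite exprS -mulmxE mulmxA.
    by rewrite -[w]mulmx1 -K2C2 mulmxA (quot0_sub q2 wN).
  have [p1 p1n H1] := pencil_unit (B := K1 *m rho y0 *m C1) (or_introl u1).
  have [p2 p2n H2] := pencil_unit (A := K2 *m rho y1 *m C2) (or_intror u2).
  (* Here [y1] is invertible on [N] and [y0] on the quotient; outside the roots of two polynomials,
     [t y0 + y1] is invertible on both. *)
  have [|t] := poly_natr_nonroot (p := p1 * p2); first by rewrite mulf_neq0.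
  rewrite hornerM mulf_eq0 negb_or => /andP [/H1 {}H1 /H2 {}H2].
  left; set y := t%:R *: y0 + y1; have yh : y \in h by rewrite memvD ?memvZ.
  exists y => //.
  have {}H1 : K1 *m rho y *m C1 \in unitmx.
    by rewrite lin mulmxDr mulmxDl -scalemxAr -scalemxAl addrC.
  have {}H2 : K2 *m rho y *m C2 \in unitmx.
    by rewrite lin mulmxDr mulmxDl -scalemxAr -scalemxAl addrC.
  rewrite -row_free_unit -kermx_eq0; apply/eqP/row_matrixP => i; rewrite row0.
  set v := row i _.
  have vr : v *m rho y = 0 by rewrite -row_mul mulmx_ker row0.
  have vN : (v <= N)%MS.
    apply: (sub_quot0 q2); first exact: submx1.
    rewrite -[v *m C2](mulmxK H2).
    have := submx_trans (submxMr (rho y) (sub2 _ v (submx1 _))) (sN _ yh).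
    move/(quot0_sub q2); rewrite !mulmxBl vr mul0mx sub0r => /eqP.
    by rewrite oppr_eq0 -!mulmxA => /eqP; rewrite !mulmxA => ->; rewrite mul0mx.
  have := sub1 _ v vN; rewrite submx0 subr_eq0 => /eqP vE.
  suff -> : v = 0 by [].
  rewrite vE -[v *m C1](mulmxK H1).
  by rewrite !mulmxA -vE vr !mul0mx.
- right; exists (v *m K1).
    by apply: contraNneq v0 => vK; rewrite -[v]mulmx1 -K1C1 mulmxA vK mul0mx.
  move=> y yh; apply/eqP; rewrite -submx0; apply: (sub_quot0 q1).
    by apply: submx_trans (sN y yh); apply: submxMr; apply: mulmx_sub.
  by rewrite -(vn y yh) !mulmxA.
Qed.

(** Apply the dichotomy to [h] acting on [L / h]. A nonzero vector killed by [h] would come from an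
    element normalising [h] but outside it, so some [h0] is invertible on [L / h]. *)
Lemma cartan_regular : self_normalizing br h ->
  exists2 h0, h0 \in h & forall x, exists a y, a \in h /\ x = a + br y h0.
Proof.
move=> normh; have linc := @lie_coordP F L.
have [||H SH] := @mx_of_pred F _ (fun v => exists2 x : L, x \in h & v = lie_coord x).
- by exists 0; rewrite ?mem0v // (lin0 linc).
- move=> a u v [x xh ->] [y yh ->]; exists (a *: x + y); rewrite ?linc //.
  by rewrite memvD // memvZ.
have inH x : (lie_coord x <= H)%MS -> x \in h.
  by move/SH => [y yh /lie_coord_inj ->].
have sH y : y \in h -> stablemx H (adjoint_mx br y).
  move=> yh; apply/row_subP => i; rewrite row_mul.
  have /SH [x xh ->] := row_sub i H; rewrite -lie_coord_br //.
  by apply/SH; exists (br x y) => //; apply: subh.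
have [r [K [C qb]]] := quot_basis_exists (submx1 H).
have [KC _ _ sub] := qb; have [lin rbr] := adjoint_rep lieL.
have [|x y xh yh|[h0 h0h u]|[v v0 vn]] :=
  @nilpotent_dichotomy r (fun y => K *m adjoint_mx br y *m C).
- by move=> a x y; rewrite lin mulmxDr mulmxDl -scalemxAr -scalemxAl.
- rewrite !(quot_mulmx qb) ?sH ?submx1 //.
  by rewrite rbr mulmxBr mulmxBl.
- exists h0 => // x.
  pose w := lie_coord x *m C *m invmx (K *m adjoint_mx br h0 *m C).
  pose y : L := \sum_i (w *m K) 0 i *: lie_basis i.
  exists (x - br y h0), y; rewrite subrK; split=> //; apply: inH.
  rewrite (linD linc) (linN linc) lie_coord_br // lie_coordK.
  apply: (sub_quot0 qb); first exact: submx1.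
  by rewrite mulmxBl -(mulmxA w) -(mulmxA w) mulmxKV // subrr.
- case/eqP: v0; rewrite -[v]mulmx1 -KC mulmxA; apply: (quot0_sub qb).
  rewrite -(lie_coordK (v *m K)); set x := \sum_i _.
  apply/SH; exists x => //; apply: normh => y yh; apply: inH.
  rewrite lie_coord_br // lie_coordK; apply: (sub_quot0 qb); first exact: submx1.
  by rewrite -(vn y yh) !mulmxA.
Qed.

End Engel.

(** * The simple coroots span the Cartan subalgebra *)

Section Coroots.
Variables (F : numClosedFieldType) (L : vectType F) (br : L -> L -> L).
Hypothesis lieL : lie_algebra br.
Variable h : {vspace L}.

Lemma coroot_sl2 (lam : L -> F) hv : lin_functional lam -> coroot br h lam hv ->
  exists x z, [/\ in_weight_space br h lam x, in_weight_space br h (fun y => - lam y) z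
    & [/\ br hv x = 2 *: x, br hv z = - 2 *: z, br x z = hv & x != 0]].
Proof.
move=> lin [hvh [x [z [wx wz hvE]]] lam2].
exists x, z; split=> //; split=> //.
- by rewrite (wx _ hvh) lam2.
- by rewrite (wz _ hvh) lam2.
apply/eqP => x0; move/eqP: lam2; rewrite hvE x0.
have -> : br 0 z = 0.
  by case: lieL => brl _ _ _; apply: (@lin0 _ _ _ (fun x => br x z)) => *; apply: brl.
have -> : lam 0 = 0 by apply: (@lin0 F L F^o).
by rewrite eq_sym pnatr_eq0.
Qed.

Lemma coroots_span (Phi : finType) (alpha : Phi -> L -> F) n (s : 'I_n -> Phi)
    (hc : 'I_n -> L) : root_system br h alpha -> simple_roots h alpha s ->
  (forall i, coroot br h (alpha (s i)) (hc i)) ->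
  forall x, x \in h -> exists c : 'I_n -> F, x = \sum_i c i *: hc i.
Proof.
case=> alin _ _ _ _ [nE ind _] cor x xh.
pose X := [tuple hc i | i < n].
have XE (i : 'I_n) : X`_i = hc i by rewrite -tnth_nth tnth_mktuple.
have repA := adjoint_rep lieL; set K := trace_form (adjoint_mx br).
have fX : free X.
  apply/freeP => k Xk i.
  have sl2 j := coroot_sl2 (alin (s j)) (cor j).
  (* The constant [cc j] is [K u z] for root vectors [u], [z] with [br u z = hc j]. If it vanished,
     so would [K (hc j) (hc j)], making [u] central, against [br (hc j) u = 2 *: u]. A relation
     among coroots thus becomes one among simple roots. *)
  have [cc Hcc] : exists cc : 'I_n -> F, (forall j, cc j != 0) /\
      forall j y, y \in h -> K (hc j) y = cc j * alpha (s j) y.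
    suff H j : exists c, c != 0 /\ forall y, y \in h -> K (hc j) y = c * alpha (s j) y.
      have [g Hg] := fin_all_exists H.
      by exists g; split=> j; case: (Hg j).
    have [u [z [wu wz [hu hz uz u0]]]] := sl2 j.
    have Ky y : y \in h -> K (hc j) y = K u z * alpha (s j) y.
      move=> yh; rewrite /K -uz (trace_form_inv repA) br_anti // wz //.
      rewrite -scaleNr opprK /trace_form; case: (repA) => lin _.
      by rewrite (linZ lin) -scalemxAr mxtraceZ mulrC.
    exists (K u z); split=> //; apply/eqP => Kuz.
    have : adjoint_mx br u = 0.
      apply: (sl2_trace_form_eq0 repA hu hz uz).
      by case: (cor j) => hch _ _; rewrite -/(K _ _) Ky // Kuz mul0r.
    move=> au; have : lie_coord (br (hc j) u) = 0 by rewrite lie_coord_br // au mulmx0.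
    rewrite hu (linZ (@lie_coordP _ _)) => /eqP; rewrite scaler_eq0 pnatr_eq0 /=.
    rewrite -(lin0 (@lie_coordP _ L)) (inj_eq (@lie_coord_inj _ _)).
    by rewrite (negPf u0).
  case: Hcc => ccn Hcc.
  suff /eqP : k i * cc i = 0 by rewrite mulf_eq0 (negPf (ccn i)) orbF => /eqP.
  apply: (ind (fun j => k j * cc j)) => y yh.
  have : K (\sum_(i < n) k i *: X`_i) y = 0.
    by rewrite Xk /K /trace_form (lin0 (proj1 repA)) mul0mx mxtrace0.
  rewrite /K /trace_form (lin_sum (proj1 repA)) mulmx_suml raddf_sum /= => K0.
  rewrite -[RHS]K0; apply: eq_bigr => j _; rewrite (linZ (proj1 repA)) /= -scalemxAl mxtraceZ XE.
  by rewrite -/(trace_form _ _ _) -/K Hcc // mulrA.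
have sX : (<<X>> <= h)%VS.
  apply/span_subvP => u /tnthP [i ->]; rewrite tnth_mktuple.
  by case: (cor i).
have hX : <<X>>%VS = h.
  apply/eqP; rewrite eqEdim sX -nE.
  by rewrite (eqP fX) size_tuple leqnn.
exists (fun i => coord X i x); rewrite -hX in xh.
by rewrite {1}(coord_span xh); apply: eq_bigr => i _; rewrite XE.
Qed.

End Coroots.

(* A functional [tau] on words that respects [x y - y x = br x y] is one on the
   enveloping algebra. If it vanishes on shorter words it is symmetric on words of
   length [j]; there, invariance pushes its vanishing from [h] to all of [L]. *)
Section TraceWords.
Variables (F : numFieldType) (L : lmodType F) (br : L -> L -> L) (tau : seq L -> F).
Hypothesis tau_lin : forall u v a x y,
  tau (u ++ (a *: x + y) :: v) = a * tau (u ++ x :: v) + tau (u ++ y :: v).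
Hypothesis tau_swap : forall u v x y,
  tau (u ++ x :: y :: v) = tau (u ++ y :: x :: v) + tau (u ++ br x y :: v).
Hypothesis tau_cyc : forall x w, tau (x :: w) = tau (rcons w x).
Variable h : L -> Prop.
Hypothesis hlin : forall a x y, h x -> h y -> h (a *: x + y).
Hypothesis tau_pow : forall x j, h x -> tau (nseq j x) = 0.
Variable h0 : L.
Hypothesis h0h : h h0.
Hypothesis h0reg : forall x, exists a y, h a /\ x = a + br y h0.

(** The Leibniz terms of the derivation of the tensor algebra extending [br y]. Modulo the
    enveloping relations their sum is a commutator with [y]. *)
Fixpoint ad_word y (w : seq L) : seq (seq L) :=
  if w is x :: w' then (br y x :: w') :: map (cons x) (ad_word y w') else [::].

Lemma ad_word_sum y w u :
  \sum_(w' <- ad_word y w) tau (u ++ w') = tau (u ++ y :: w) - tau (u ++ rcons w y).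
Proof.
elim: w u => [|x w IH] u /=; first by rewrite big_nil subrr.
rewrite big_cons big_map tau_swap.
under eq_bigr => w' _ do rewrite -cat_rcons.
by rewrite IH !cat_rcons; ring.
Qed.

Lemma ad_word_sum0 y w : \sum_(w' <- ad_word y w) tau w' = 0.
Proof. by rewrite (ad_word_sum y w [::]) /= tau_cyc subrr. Qed.

Lemma ad_word_cat y a b :
  ad_word y (a ++ b) = map (cat^~ b) (ad_word y a) ++ map (cat a) (ad_word y b).
Proof.
elim: a => [|x a IH] /=; first by rewrite map_id.
by rewrite IH map_cat -!map_comp.
Qed.

Lemma size_ad_word y w w' : w' \in ad_word y w -> size w' = size w.
Proof.
elim: w w' => // x w IH w' /=; rewrite inE => /orP [/eqP -> //|].
by case/mapP => v /IH sv -> /=; rewrite sv.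
Qed.

Lemma ad_word_nseq y x n w : w \in ad_word y (nseq n x) ->
  perm_eq w (br y x :: nseq n.-1 x).
Proof.
elim: n w => // n IH w /=; rewrite inE => /orP [/eqP -> //|/mapP [v vin ->]].
have := IH _ vin; case: n {IH} vin => // n _ pv /=.
rewrite -(perm_cons x) in pv; apply: perm_trans pv _.
by rewrite -[x :: br y x :: _]/([:: x] ++ [:: br y x] ++ _) perm_catCA.
Qed.

Lemma size_ad_word_nseq y x n : size (ad_word y (nseq n x)) = n.
Proof. by elim: n => //= n IH; rewrite size_map IH. Qed.

Section FixedLength.
Variable j : nat.
Hypothesis short : forall w, (size w < j)%N -> tau w = 0.

(** Exchanging neighbours costs a word that is one letter shorter, where [tau] vanishes. *)
Lemma tau_move u a x b : size (u ++ a ++ x :: b) = j ->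
  tau (u ++ a ++ x :: b) = tau (u ++ x :: a ++ b).
Proof.
elim: a u => //= y a IH u sz.
rewrite -cat_rcons IH; last by rewrite cat_rcons.
rewrite cat_rcons tau_swap [X in _ + X]short ?addr0 //.
by move: sz; rewrite !size_cat /= !size_cat /= => <-; rewrite !addnS.
Qed.

Lemma tau_perm w w' u : perm_eq w w' -> size (u ++ w) = j -> tau (u ++ w) = tau (u ++ w').
Proof.
elim: w w' u => [|x w IH] w' u; first by move/perm_size/esym/size0nil ->.
move=> pw sz; have xw : x \in w' by rewrite -(perm_mem pw) mem_head.
case/splitPr: xw pw => a b pw.
have pw' : perm_eq w (a ++ b).
  by rewrite -(perm_cons x) (perm_trans pw) // perm_catC /= perm_cons perm_catC.
rewrite tau_move; last by rewrite -sz !size_cat (perm_size pw) size_cat.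
by rewrite -!cat_rcons; apply: IH; rewrite ?cat_rcons.
Qed.

(** Polarization: [q] expands a power of [t *: z + y], and symmetry merges the [p] terms that are
    linear in [z]. *)
Lemma tau_expand p u y z : (size u + p)%N = j ->
  exists2 q : {poly F}, q`_1 = p%:R * tau (u ++ z :: nseq p.-1 y)
    & forall t, q.[t] = tau (u ++ nseq p (t *: z + y)).
Proof.
elim: p u => [|p IH] u sz.
  by exists (tau u)%:P => [|t]; rewrite ?coefC ?mul0r // hornerC cats0.
have [q1 _ H1] := IH (rcons u z) ltac:(by rewrite size_rcons addSnnS).
have [q2 c2 H2] := IH (rcons u y) ltac:(by rewrite size_rcons addSnnS).
exists ('X * q1 + q2) => [|t]; last first.
  by rewrite hornerD hornerM hornerX H1 H2 !cat_rcons tau_lin.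
rewrite coefD coefXM /= -horner_coef0 H1 scale0r add0r cat_rcons c2 cat_rcons.
case: p {IH H1 H2 c2} sz => [|p] sz; first by rewrite mul0r mul1r addr0.
rewrite (_ : tau (u ++ y :: z :: _) = tau (u ++ z :: nseq p.+1 y)).
  by rewrite -{1}[tau _]mul1r -mulrDl -[p.+2]add1n natrD.
apply: tau_perm; last by rewrite -sz size_cat /= size_nseq.
by rewrite -[y :: z :: _]/([:: y] ++ [:: z] ++ _) perm_catCA.
Qed.

(** By induction on [xs], the polynomial of [tau_expand] vanishes at every natural number, since
    [t *: z + y] stays in [h]. Hence its linear coefficient is zero. *)
Lemma tau_polar xs p y : (forall x, x \in xs -> h x) -> h y -> (size xs + p)%N = j ->
  tau (xs ++ nseq p y) = 0.
Proof.
elim/last_ind: xs p y => [|xs z IH] p y xsh yh sz; first exact: tau_pow.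
have zh : h z by apply: xsh; rewrite mem_rcons mem_head.
have [|q q1 Hq] := @tau_expand p.+1 xs y z; first by rewrite -sz size_rcons addSnnS.
have q0 : q = 0.
  apply/eqP/negPn/negP => /poly_natr_nonroot [t]; rewrite Hq IH ?eqxx //.
  - by move=> x xin; apply: xsh; rewrite mem_rcons inE xin orbT.
  - exact: hlin.
  - by rewrite -sz size_rcons addSnnS.
move/esym/eqP: q1; rewrite q0 coef0 mulf_eq0 pnatr_eq0 /= => /eqP.
by rewrite cat_rcons.
Qed.

Lemma tau_h w : (forall x, x \in w -> h x) -> size w = j -> tau w = 0.
Proof. by move=> wh sw; rewrite -[w]cats0 (tau_polar (p := 0) (y := h0)) ?addn0. Qed.

(** The outer induction is on the number of letters after the leading [h0]'s. The inner one replaces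
    these letters by elements of [h], writing each as [a + br y h0]; once all are in [h],
    polarization applies. *)
Lemma tau_regular q p vs : size vs = q -> (p + q)%N = j -> tau (nseq p h0 ++ vs) = 0.
Proof.
elim: q p vs => [|q IHq] p vs svs pq.
  by move/size0nil: svs ->; rewrite cats0; apply: tau_pow.
suff H : forall bs as_, (forall x, x \in as_ -> h x) -> (size as_ + size bs)%N = q.+1 ->
    tau (nseq p h0 ++ as_ ++ bs) = 0 by apply: (H vs [::]).
elim=> [|b bs IH] as_ ash sz.
  rewrite cats0; apply: tau_h.
    by move=> x; rewrite mem_cat => /orP [/nseqP [-> _] //|/ash].
  by rewrite size_cat size_nseq -pq -sz addn0.
have [a [y [ah ->]]] := h0reg b.
rewrite -[a]scale1r catA tau_lin mul1r.
have -> : tau ((nseq p h0 ++ as_) ++ a :: bs) = 0.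
  rewrite -catA -cat_rcons IH // => [x|]; last by rewrite size_rcons addSnnS.
  by rewrite mem_rcons inE => /orP [/eqP -> //|/ash].
rewrite add0r.
(* Invariance is applied to the word in which an extra [h0] stands in for [br y h0]. Terms hitting
   [as_ ++ bs] keep [p + 1] leading [h0]'s and vanish by the outer induction; the other [p + 1]
   terms all equal [X]. *)
have := ad_word_sum0 y (nseq p.+1 h0 ++ as_ ++ bs).
rewrite ad_word_cat big_cat !big_map /= [X in _ + X]big_seq [X in _ + X]big1 ?addr0; last first.
  move=> w' /size_ad_word sw; rewrite -[h0 :: _]/(nseq p.+1 h0 ++ w') IHq //.
    by rewrite sw size_cat; move: sz; rewrite /= addnS => -[].
  by rewrite addSnnS.
set X := tau _.
rewrite big_seq (eq_bigr (fun=> X)).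
  rewrite -big_seq big_const_seq count_predT iter_addr_0.
  rewrite (size_ad_word_nseq y h0 p.+1) => /eqP.
  by rewrite -mulr_natr mulf_eq0 pnatr_eq0 orbF => /eqP.
move=> w' /(@ad_word_nseq y h0 p.+1) /= pw; rewrite /X -catA.
have sw : size w' = p.+1 by rewrite (perm_size pw) /= size_nseq.
apply: (@tau_perm _ _ [::]).
  apply: (perm_trans (y := (br y h0 :: nseq p h0) ++ as_ ++ bs)).
    by rewrite perm_cat2r.
  rewrite /= -[br y h0 :: (_ ++ _)]/([:: br y h0] ++ nseq p h0 ++ as_ ++ bs).
  by rewrite perm_catCA perm_cat2l perm_catCA.
by rewrite /= !size_cat sw -pq -sz /= !addnS addSn.
Qed.

End FixedLength.

Lemma tau_vanish w : tau w = 0.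
Proof.
have [j] := ubnP (size w); elim: j w => // j IH w; rewrite ltnS leq_eqVlt.
case/orP => [/eqP sw|/IH //].
exact: (@tau_regular j IH j 0%N w).
Qed.

End TraceWords.

(** * Hom modules in matrix form *)

Section HomRep.
Variable F : numClosedFieldType.

Lemma mxvec_ext a b p (A B : 'M[F]_(a * b, p)) :
  (forall T : 'M[F]_(a, b), mxvec T *m A = mxvec T *m B) -> A = B.
Proof.
move=> AB; apply/row_matrixP => i; rewrite !rowE -[delta_mx _ _]vec_mxK.
exact: AB.
Qed.

Lemma mxvec_mulr a b (T : 'M[F]_(a, b)) (A : 'M[F]_b) :
  mxvec T *m lin_mulmxr A = mxvec (T *m A).
Proof. exact: mul_vec_lin. Qed.

Lemma mxvec_mull a b (T : 'M[F]_(a, b)) (A : 'M[F]_a) :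
  mxvec T *m lin_mulmx A = mxvec (A *m T).
Proof. exact: mul_vec_lin. Qed.

(** The action on flattened matrices [T], chosen so that the invariants are exactly the
    intertwiners. *)
Definition hom_mx a b (B : 'M[F]_a) (A : 'M[F]_b) : 'M[F]_(a * b) :=
  lin_mulmxr A - lin_mulmx B.

Lemma mxvec_hom a b (T : 'M[F]_(a, b)) B A :
  mxvec T *m hom_mx B A = mxvec (T *m A - B *m T).
Proof. by rewrite mulmxBr mxvec_mulr mxvec_mull raddfB. Qed.

Lemma trace_lin_mulmx a b (B : 'M[F]_a) (A : 'M[F]_b) :
  \tr (lin_mulmxr A *m lin_mulmx B : 'M[F]_(a * b)) = \tr A * \tr B.
Proof.
set M := _ *m _.
transitivity (\sum_i \sum_j M (mxvec_index i j) (mxvec_index i j)).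
  rewrite pair_bigA /= /mxtrace (reindex _ (curry_mxvec_bij _ _)) /=.
  by apply: eq_bigr => -[i j].
rewrite mulrC big_distrl /=; apply: eq_bigr => i _.
rewrite big_distrr /=; apply: eq_bigr => j _.
have -> : M (mxvec_index i j) (mxvec_index i j) =
    (mxvec (delta_mx i j) *m M) 0 (mxvec_index i j).
  by rewrite mxvec_delta -rowE [RHS]mxE.
rewrite /M mulmxA mxvec_mulr mxvec_mull mxvecE mxE (bigD1 i) //=.
rewrite [X in _ + X]big1 => [|l neli]; last first.
  rewrite [X in _ * X]mxE big1 ?mulr0 // => l' _.
  by rewrite mxE (negPf neli) mul0r.
rewrite addr0 [X in _ * X]mxE (bigD1 j) //= big1 => [|l nelj]; last first.
  by rewrite mxE (negPf nelj) andbF mul0r.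
by rewrite mxE !eqxx mul1r addr0.
Qed.

Lemma lin_mulmxrX a b (A : 'M[F]_b) i :
  (lin_mulmxr A : 'M[F]_(a * b)) ^+ i = lin_mulmxr (A ^+ i).
Proof.
elim: i => [|i IH]; apply: mxvec_ext => T.
  by rewrite !expr0 mulmx1 mxvec_mulr mulmx1.
by rewrite exprSr IH -mulmxE mulmxA !mxvec_mulr exprSr -mulmxE mulmxA.
Qed.

Lemma lin_mulmxX a b (A : 'M[F]_a) i :
  (lin_mulmx A : 'M[F]_(a * b)) ^+ i = lin_mulmx (A ^+ i).
Proof.
elim: i => [|i IH]; apply: mxvec_ext => T.
  by rewrite !expr0 mulmx1 mxvec_mull mul1mx.
by rewrite exprSr IH -mulmxE mulmxA !mxvec_mull exprS -mulmxE mulmxA.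
Qed.

(** Left and right multiplications commute, so the binomial formula applies. Only the power traces
    of [A] and [B] enter, so equal traces on modules give equal traces on Hom modules. *)
Lemma trace_hom_exp a b (B : 'M[F]_a) (A : 'M[F]_b) j :
  \tr (hom_mx B A ^+ j) =
  \sum_(i < j.+1) ((-1) ^+ i * (\tr (A ^+ (j - i)) * \tr (B ^+ i))) *+ 'C(j, i).
Proof.
rewrite exprBn_comm; last first.
  apply: mxvec_ext => T.
  by rewrite -!mulmxE !mulmxA !(mxvec_mulr, mxvec_mull) mulmxA.
rewrite raddf_sum; apply: eq_bigr => i _; rewrite raddfMn; congr (_ *+ _) => /=.
rewrite lin_mulmxrX lin_mulmxX -trace_lin_mulmx -signr_odd -[in RHS]signr_odd.
case: (odd i); last by rewrite !expr0 !mul1r mulmxE.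
by rewrite !expr1 !mulN1r mulNr raddfN /= mulmxE.
Qed.

Variables (L : vectType F) (br : L -> L -> L).

Lemma hom_rep a b (psi : L -> 'M[F]_a) (phi : L -> 'M[F]_b) :
  lie_rep br psi -> lie_rep br phi -> lie_rep br (fun x => hom_mx (psi x) (phi x)).
Proof.
move=> [l1 r1] [l2 r2]; split=> [c x y|x y]; apply: mxvec_ext => T.
  rewrite [RHS]mulmxDr -scalemxAr !mxvec_hom -linearP /=; congr mxvec.
  by rewrite l1 l2 mulmxDr mulmxDl -scalemxAr -scalemxAl scalerBr addrACA opprD.
rewrite [RHS]mulmxBr !mulmxA !mxvec_hom -linearB /= r1 r2; congr mxvec.
rewrite !mulmxBr !mulmxBl !mulmxA.
move: (T *m _ *m phi y) (T *m _ *m phi x) (psi x *m psi y *m T) (psi y *m psi x *m T).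
move: (psi x *m T *m phi y) (psi y *m T *m phi x) => p1 p2 p3 p4 p5 p6.
apply/matrixP => i j.
by rewrite !mxE; ring.
Qed.

End HomRep.

(** * Action of words, the monomials of the enveloping algebra *)

Section Words.
Variables (F : numClosedFieldType) (L : vectType F) (br : L -> L -> L).

Definition word_mx d (rho : L -> 'M[F]_d) (w : seq L) : 'M[F]_d :=
  foldr (fun x A => rho x *m A) 1%:M w.

Lemma word_mx_cat d (rho : L -> 'M[F]_d) u v :
  word_mx rho (u ++ v) = word_mx rho u *m word_mx rho v.
Proof. by elim: u => [|x u IH] /=; rewrite ?mul1mx // IH mulmxA. Qed.

Lemma word_mx_nseq d (rho : L -> 'M[F]_d) j x : word_mx rho (nseq j x) = rho x ^+ j.
Proof. by elim: j => [|j IH] //=; rewrite IH exprS. Qed.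

Lemma word_mx_stable d (rho : L -> 'M[F]_d) (N : 'M[F]_d) w :
  (forall x, stablemx N (rho x)) -> stablemx N (word_mx rho w).
Proof.
move=> sN; elim: w => [|x w IH] /=; first by rewrite mulmx1.
by rewrite mulmxA; apply: submx_trans IH; apply: submxMr.
Qed.

Lemma word_mx_quot d r (rho : L -> 'M[F]_d) (N1 N2 : 'M[F]_d) (K : 'M[F]_(r, d)) C w :
  quot_basis N1 N2 K C ->
  (forall x, stablemx N1 (rho x)) -> (forall x, stablemx N2 (rho x)) ->
  word_mx (fun x => K *m rho x *m C) w = K *m word_mx rho w *m C.
Proof.
move=> qb s1 s2; elim: w => [|x w IH] /=; first by case: qb => KC *; rewrite mulmx1.
by rewrite IH (quot_mulmx qb) // word_mx_stable.
Qed.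

Lemma word_mx_lin d (rho : L -> 'M[F]_d) u v a x y : lie_rep br rho ->
  word_mx rho (u ++ (a *: x + y) :: v) =
  a *: word_mx rho (u ++ x :: v) + word_mx rho (u ++ y :: v).
Proof.
case=> lin _; rewrite !word_mx_cat /= lin mulmxDl mulmxDr.
by rewrite -scalemxAl -scalemxAr.
Qed.

Lemma word_mx_swap d (rho : L -> 'M[F]_d) u v x y : lie_rep br rho ->
  word_mx rho (u ++ x :: y :: v) =
  word_mx rho (u ++ y :: x :: v) + word_mx rho (u ++ br x y :: v).
Proof.
case=> _ rbr; rewrite !word_mx_cat /= rbr mulmxBl mulmxBr !mulmxA.
by rewrite addrC subrK.
Qed.

Lemma trace_word_cyc d (rho : L -> 'M[F]_d) x w :
  \tr (word_mx rho (x :: w)) = \tr (word_mx rho (rcons w x)).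
Proof. by rewrite -cats1 word_mx_cat /= mulmx1 mxtrace_mulC. Qed.

End Words.

(** * From equal traces to an isomorphism *)

Section Isomorphism.
Variables (F : numClosedFieldType) (L : vectType F) (br : L -> L -> L).
Hypothesis simpL : simple_lie br.
Variables e h f : L.
Hypothesis (he : br h e = 2 *: e) (hf : br h f = - 2 *: f) (ef : br e f = h).
Hypothesis e0 : e != 0.
Variables (H : {vspace L}) (h0 : L).
Hypothesis h0H : h0 \in H.
Hypothesis h0reg : forall x, exists a y, a \in H /\ x = a + br y h0.

Let whiteheadL := whitehead simpL he hf ef e0.

Definition same_pow_traces m k (phi : L -> 'M[F]_m) (psi : L -> 'M[F]_k) :=
  forall x j, x \in H -> \tr (phi x ^+ j) = \tr (psi x ^+ j).

Lemma same_word_traces m k (phi : L -> 'M[F]_m) (psi : L -> 'M[F]_k) :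
  lie_rep br phi -> lie_rep br psi -> same_pow_traces phi psi ->
  forall w, \tr (word_mx phi w) = \tr (word_mx psi w).
Proof.
move=> rphi rpsi tr w; apply/eqP; rewrite -subr_eq0; apply/eqP.
apply: (@tau_vanish F L br (fun w => \tr (word_mx phi w) - \tr (word_mx psi w))
  _ _ _ (fun x => x \in H) _ _ h0) => //.
- move=> u v a x y; rewrite !(word_mx_lin _ _ _ _ _ rphi) !(word_mx_lin _ _ _ _ _ rpsi).
  by rewrite !mxtraceD !mxtraceZ; ring.
- move=> u v x y; rewrite (word_mx_swap _ _ x y rphi) (word_mx_swap _ _ x y rpsi).
  by rewrite !mxtraceD; ring.
- by move=> x u; rewrite !trace_word_cyc.
- by move=> a x y xH yH; rewrite memvD ?memvZ.
- by move=> x j xH; rewrite !word_mx_nseq tr // subrr.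
Qed.

(** The power [j = 0] compares traces of identity matrices, in characteristic zero. *)
Lemma same_pow_traces_dim m k (phi : L -> 'M[F]_m) (psi : L -> 'M[F]_k) :
  same_pow_traces phi psi -> m = k.
Proof.
move/(_ 0 0%N (mem0v _)); rewrite !expr0 !mxtrace1 => /eqP.
by rewrite eqr_nat => /eqP.
Qed.

Definition word_comb d (rho : L -> 'M[F]_d) (l : seq (F * seq L)) : 'M[F]_d :=
  \sum_(p <- l) p.1 *: word_mx rho p.2.

(* The augmentation ideal of the enveloping algebra then contains an element acting
   as the identity: apply [whitehead] to its image in the matrices, with [m = 1]. *)
Lemma no_invariant_unit d (rho : L -> 'M[F]_d) : lie_rep br rho ->
  (forall v : 'rV[F]_d, (forall x, v *m rho x = 0) -> v = 0) ->
  exists2 l, all (fun p => 0 < size p.2)%N l & word_comb rho l = 1%:M.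
Proof.
move=> rep noinv; have [lin rbr] := rep.
pose R x : 'M[F]_(d * d) := lin_mulmxr (rho x).
have repR : lie_rep br R.
  split=> [a x y|x y]; apply: mxvec_ext => T.
    by rewrite mulmxDr -scalemxAr !mxvec_mulr lin mulmxDr -scalemxAr linearP.
  by rewrite mulmxBr !mulmxA !mxvec_mulr rbr mulmxBr linearB /= !mulmxA.
have [||N SN] := @mx_of_pred F _ (fun v => exists2 l,
    all (fun p => 0 < size p.2)%N l & v = mxvec (word_comb rho l)).
- by exists [::] => //; rewrite /word_comb big_nil linear0.
- move=> a _ _ [l1 n1 ->] [l2 n2 ->].
  exists ([seq (a * p.1, p.2) | p <- l1] ++ l2).
    by rewrite all_cat all_map n2 andbT.
  rewrite -linearP /=; congr mxvec; rewrite /word_comb big_cat big_map /=.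
  by rewrite scaler_sumr; congr (_ + _); apply: eq_bigr => p _; rewrite scalerA.
have sN x : stablemx N (R x).
  apply/row_subP => i; rewrite row_mul.
  have /SN [l nl ->] := row_sub i N; apply/SN.
  exists [seq (p.1, rcons p.2 x) | p <- l].
    by rewrite all_map; apply: sub_all nl => p; rewrite /= size_rcons.
  rewrite mxvec_mulr /word_comb big_map mulmx_suml; congr mxvec.
  apply: eq_bigr => p _ /=.
  by rewrite -cats1 word_mx_cat /= mulmx1 -scalemxAl.
have s0 x : stablemx (0 : 'M[F]_(d * d)) (R x) by rewrite mul0mx sub0mx.
have [|n /SN [l nl ->] Hn] := whiteheadL (m := mxvec 1%:M) repR (sub0mx _ N) s0 sN.
  move=> x; apply/SN; exists [:: (1, [:: x])] => //.
  by rewrite mxvec_mulr /word_comb big_seq1 /= scale1r mulmx1 mul1mx.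
(* Every row of the difference between [1] and the combination found is an invariant, hence zero. *)
exists l => //; apply/eqP; rewrite eq_sym -subr_eq0; apply/eqP.
apply/row_matrixP => i; rewrite row0; apply: noinv => x; rewrite -row_mul.
have := Hn x; rewrite submx0 -linearB mxvec_mulr.
by rewrite mxvec_eq0 => /eqP ->; rewrite row0.
Qed.

(** Suppose [rho2] has no invariants. The quotient [q] of [rho1] by its invariants [N] has none
    either, as [L] is perfect. One augmentation element then acts as the identity on both [q] and
    [rho2]; as it kills [N], its trace on [rho1] is the dimension of [q], while on [rho2] it is
    [d2 = d1]. So [N = 0]. *)
Lemma invariant_transfer d1 d2 (rho1 : L -> 'M[F]_d1) (rho2 : L -> 'M[F]_d2) :
  lie_rep br rho1 -> lie_rep br rho2 -> same_pow_traces rho1 rho2 ->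
  (exists2 v : 'rV[F]_d1, v != 0 & forall x, v *m rho1 x = 0) ->
  exists2 v : 'rV[F]_d2, v != 0 & forall x, v *m rho2 x = 0.
Proof.
move=> rep1 rep2 tr [v1 v1n v1inv]; apply: NNPP => ninv.
have [lin1 br1] := rep1; have [lin2 br2] := rep2.
have inv2 (v : 'rV[F]_d2) : (forall x, v *m rho2 x = 0) -> v = 0.
  by move=> vx; apply: NNPP => /eqP vn; apply: ninv; exists v.
have [||N SN] := @mx_of_pred F d1 (fun v => forall x, v *m rho1 x = 0).
- by move=> x; rewrite mul0mx.
- by move=> a u v ux vx x; rewrite mulmxDl -scalemxAl ux vx scaler0 addr0.
have N0 x : N *m rho1 x = 0.
  by apply/row_matrixP => i; rewrite row_mul row0; apply: (SN _).2 (row_sub i N) x.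
have sN x : stablemx N (rho1 x) by rewrite N0 sub0mx.
have s1 x : stablemx (1%:M : 'M[F]_d1) (rho1 x) by apply: submx1.
have [r1 [K1 [C1 q1]]] := quot_basis_exists (sub0mx d1 N).
have [r2 [K2 [C2 q2]]] := quot_basis_exists (submx1 N).
have repq := quot_rep rep1 sN s1 q2.
set q := fun x => _ in repq; have [linq brq] := repq.
have invq (v : 'rV[F]_r2) : (forall x, v *m q x = 0) -> v = 0.
  move=> vq; suff vK : (v *m K2 <= N)%MS.
    by case: (q2) => KC _ _ _; rewrite -[v]mulmx1 -KC mulmxA (quot0_sub q2 vK).
  apply/SN.
  have vN x : (v *m K2 *m rho1 x <= N)%MS.
    apply: (sub_quot0 q2); first exact: submx1.
    by rewrite -(vq x) /q !mulmxA.
  apply: (simple_perfect simpL).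
  - by rewrite (lin0 lin1) mulmx0.
  - by move=> a x y vx vy; rewrite lin1 mulmxDr -scalemxAr vx vy scaler0 addr0.
  - move=> x y; rewrite br1 mulmxBr !mulmxA.
    have /submxP [w ->] := vN x; have /submxP [w' ->] := vN y.
    by rewrite -!mulmxA !N0 !mulmx0 subr0.
(* The direct sum forces a single combination [l] to serve both modules. *)
pose blk x : 'M[F]_(r2 + d2) := block_mx (q x) 0 0 (rho2 x).
have repb : lie_rep br blk.
  split=> [a x y|x y]; rewrite /blk.
    by rewrite scale_block_mx add_block_mx linq lin2 !scaler0 !addr0.
  rewrite !mulmx_block brq br2 !mul0mx !mulmx0 !addr0 !add0r.
  by rewrite opp_block_mx add_block_mx !oppr0 !addr0.
have wb w : word_mx blk w = block_mx (word_mx q w) 0 0 (word_mx rho2 w).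
  elim: w => [|x w IH] /=; first by rewrite -scalar_mx_block.
  by rewrite IH mulmx_block !mul0mx !mulmx0 !addr0 !add0r.
have [v|l nl l1] := no_invariant_unit repb.
  rewrite -[v]hsubmxK => vb.
  have vb' x : lsubmx v *m q x = 0 /\ rsubmx v *m rho2 x = 0.
    have := vb x; rewrite mul_row_block !mulmx0 addr0 add0r.
    by rewrite -[0]row_mx0 => /eq_row_mx.
  have vl : lsubmx v = 0 by apply: invq => x; case: (vb' x).
  have vr : rsubmx v = 0 by apply: inv2 => x; case: (vb' x).
  by rewrite vl vr row_mx0.
have cb : word_comb blk l = block_mx (word_comb q l) 0 0 (word_comb rho2 l).
  rewrite /word_comb; elim: l {nl l1} => [|p l IH].
    by rewrite !big_nil -block_mx0.
  by rewrite !big_cons IH wb scale_block_mx add_block_mx !scaler0 !addr0.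
move: l1; rewrite cb scalar_mx_block => /eq_block_mx [c1 _ _ c2].
have trw := same_word_traces rep1 rep2 tr.
have trc d (rho : L -> 'M[F]_d) :
    \tr (word_comb rho l) = \sum_(p <- l) p.1 * \tr (word_mx rho p.2).
  by rewrite /word_comb raddf_sum; apply: eq_bigr => p _; apply: mxtraceZ.
have r2d : r2 = d1.
  apply/eqP; rewrite (same_pow_traces_dim tr) -(eqr_nat F) -!mxtrace1 -c1 -c2 !trc.
  apply/eqP; rewrite !big_seq; apply: eq_bigr => -[c w] /(allP nl) /= nw.
  rewrite -trw (word_mx_quot _ q2) // (trace_sub_quot q1 q2) ?word_mx_stable //.
  case: w nw => //= x w _; rewrite !mulmxA.
  case: (q1) => _ _ /submxP [w' ->] _.
  by rewrite -(mulmxA w') N0 mulmx0 !mul0mx mxtrace0 add0r.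
have := trace_sub_quot (A := 1%:M) q1 q2; rewrite mulmx1 => /(_ (submx_refl _)).
case: (q1) (q2) => KC1 _ _ sub1 [KC2 _ _ _]; rewrite !mulmx1 KC1 KC2 !mxtrace1 r2d.
move=> /eqP; rewrite -natrD eqr_nat -{1}[d1]add0n eqn_add2r => /eqP r10.
have := sub1 _ v1 ((SN _).1 v1inv); rewrite submx0 subr_eq0 => /eqP v1E.
case/eqP: v1n; rewrite v1E; move: (v1 *m C1) (K1); rewrite -r10 => A B.
by rewrite (thinmx0 A) mul0mx.
Qed.

(** Makes a linear splitting [T0] equivariant without changing [P T0 Q]: the hypotheses say that the
    matrices with [P T Q = 0] form a submodule of Hom containing the defect of [T0], and Whitehead's
    lemma corrects [T0] inside it. *)
Lemma hom_split a b p q (psi : L -> 'M[F]_a) (phi : L -> 'M[F]_b)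
    (P : 'M[F]_(p, a)) (Q : 'M[F]_(b, q)) (T0 : 'M[F]_(a, b)) :
  lie_rep br psi -> lie_rep br phi ->
  (forall T x, P *m T *m Q = 0 -> P *m (T *m phi x - psi x *m T) *m Q = 0) ->
  (forall x, P *m (T0 *m phi x - psi x *m T0) *m Q = 0) ->
  exists2 T, P *m T *m Q = P *m T0 *m Q & forall x, T *m phi x = psi x *m T.
Proof.
move=> rpsi rphi st sT0; have rep := hom_rep rpsi rphi.
have [||N SN] := @mx_of_pred F _ (fun v : 'rV[F]_(a * b) => P *m vec_mx v *m Q = 0).
- by rewrite linear0 mulmx0 mul0mx.
- move=> c u v u0 v0; rewrite linearP /= mulmxDr mulmxDl -scalemxAr -scalemxAl.
  by rewrite u0 v0 scaler0 addr0.
have sN x : stablemx N (hom_mx (psi x) (phi x)).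
  apply/row_subP => i; rewrite row_mul -[row i N]vec_mxK mxvec_hom; apply/SN.
  by rewrite mxvecK; apply: st; apply/SN/row_sub.
have s0 x : stablemx (0 : 'M[F]_(a * b)) (hom_mx (psi x) (phi x)).
  by rewrite mul0mx sub0mx.
have [|n /SN nN Hn] := whiteheadL (m := mxvec T0) rep (sub0mx _ N) s0 sN.
  by move=> x; rewrite mxvec_hom; apply/SN; rewrite mxvecK.
exists (T0 - vec_mx n) => [|x]; first by rewrite mulmxBr mulmxBl nN subr0.
have := Hn x; rewrite submx0 -[mxvec T0 - n]vec_mxK mxvec_hom mxvec_eq0 subr_eq0.
by rewrite linearB /= mxvecK => /eqP.
Qed.

Lemma same_pow_traces_iso m k (phi : L -> 'M[F]_m) (psi : L -> 'M[F]_k) :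
  lie_rep br phi -> lie_rep br psi -> same_pow_traces phi psi -> rep_iso phi psi.
Proof.
have [b] := ubnP m; elim: b m k phi psi => // b IH m k phi psi; rewrite ltnS => mb.
move=> rphi rpsi tr; have mk := same_pow_traces_dim tr.
have [k0|kpos] := posnP k.
  have m0 : m = 0%N by rewrite mk.
  exists 0; split; rewrite ?/row_free ?/row_full ?mxrank0 ?k0 ?m0 //.
  by move=> x; rewrite mul0mx mulmx0.
(* The identity is an invariant of the Hom module of [psi] with itself, and replacing one [psi] by
   [phi] preserves the power traces. *)
have [T Tn TI] : exists2 T : 'M[F]_(k, m), T != 0 & forall x, T *m phi x = psi x *m T.
  have [||||v vn vI] := @invariant_transfer _ _ (fun x => hom_mx (psi x) (psi x))
    (fun x => hom_mx (psi x) (phi x)).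
  - exact: hom_rep.
  - exact: hom_rep.
  - move=> x j xH; rewrite !trace_hom_exp; apply: eq_bigr => i _.
    by rewrite (tr _ (j - i)%N).
  - exists (mxvec 1%:M) => [|x]; last by rewrite mxvec_hom mulmx1 mul1mx subrr linear0.
    rewrite mxvec_eq0 -mxrank_eq0 mxrank1 -lt0n //.
  - exists (vec_mx v); first by rewrite vec_mx_eq0.
    move=> x; have := vI x; rewrite -[v]vec_mxK mxvec_hom vec_mxK => /eqP.
    by rewrite mxvec_eq0 subr_eq0 => /eqP.
have TX x j : T *m phi x ^+ j = psi x ^+ j *m T.
  elim: j => [|j IHj]; first by rewrite !expr0 mulmx1 mul1mx.
  by rewrite !exprS -!mulmxE mulmxA TI -mulmxA IHj mulmxA.
set N := kermx T; set I := <<T>>%MS.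
have NP p (A : 'M[F]_(p, k)) : A *m T = 0 <-> (A <= N)%MS by split=> /sub_kermxP.
have sN x : stablemx N (psi x).
  by apply/NP; rewrite -mulmxA -TI mulmxA mulmx_ker mul0mx.
have sI x : stablemx I (phi x).
  by rewrite (eqmxMr _ (genmxE T)) TI genmxE submxMl.
have s0 d (A : 'M[F]_d) : stablemx (0 : 'M[F]_d) A by rewrite mul0mx sub0mx.
have s1 d (A : 'M[F]_d) : stablemx (1%:M : 'M[F]_d) A by apply: submx1.
have stX d (M A : 'M[F]_d) j : stablemx M A -> stablemx M (A ^+ j).
  move=> sM; elim: j => [|j IHj]; first by rewrite expr0 mulmx1.
  by rewrite exprS -mulmxE mulmxA; apply: submx_trans IHj; apply: submxMr.
have [r [Kk [Ck qk]]] := quot_basis_exists (sub0mx k N).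
have [s [Kq [Cq qq]]] := quot_basis_exists (submx1 N).
have [r' [Kc [Cc qc]]] := quot_basis_exists (submx1 I).
have [KCk _ KkN subk] := qk; have [KCq _ _ subq] := qq; have [KCc _ _ subc] := qc.
have TE : T = Cq *m (Kq *m T).
  have /NP := subq _ 1%:M (submx1 _).
  by rewrite mulmxBl !mul1mx -mulmxA => /eqP; rewrite subr_eq0 => /eqP.
have TCc : T *m Cc = 0 by apply: (quot0_sub qc); rewrite genmxE.
have [Ci JCi] : exists Ci, (Kq *m T) *m Ci = 1%:M.
  apply/row_freeP; rewrite -kermx_eq0; apply/eqP/row_matrixP => i; rewrite row0.
  set w := row i _.
  have /NP wN : w *m Kq *m T = 0 by rewrite -mulmxA -row_mul mulmx_ker row0.
  by rewrite -[w]mulmx1 -KCq mulmxA (quot0_sub qq wN).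
(* The basis of the image [I] is the [T]-image of the chosen basis of the quotient by the kernel, so
   both carry the same matrices and cancel in the traces. *)
have qi : quot_basis 0 I (Kq *m T) Ci.
  split=> //; rewrite ?mul0mx ?genmxE ?submxMl // => p A.
  rewrite genmxE => /submxP [w ->]; rewrite submx0 {1 2}TE.
  by rewrite mulmxA -(mulmxA _ (Kq *m T) Ci) JCi mulmx1 subrr.
have tr1 : same_pow_traces (fun x => Kc *m phi x *m Cc) (fun x => Kk *m psi x *m Ck).
  move=> x j xH; rewrite (quot_exp _ qc) // (quot_exp _ qk) //.
  have := tr x j xH; rewrite (trace_sub_quot qi qc) ?stX // (trace_sub_quot qk qq) ?stX //.
  have -> : Kq *m T *m phi x ^+ j *m Ci = Kq *m psi x ^+ j *m Cq.
    rewrite -(mulmxA Kq T) TX {1}TE (mulmxA _ Cq) mulmxA -(mulmxA _ (Kq *m T) Ci) JCi.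
    by rewrite mulmx1 mulmxA.
  by rewrite addrC => /addIr.
have rphi1 := quot_rep rphi sI (fun x => s1 _ _) qc.
have rpsi1 := quot_rep rpsi (fun x => s0 _ _) sN qk.
have r'b : (r' < b)%N.
  apply: leq_trans mb; rewrite ltn_neqAle; apply/andP; split; last first.
    have : row_free Kc by apply/row_freeP; exists Cc.
    by rewrite -row_leq_rank => /leq_trans -> //; apply: rank_leq_col.
  apply: contraNneq Tn => r'm; subst r'.
  have [Cu _] := mulmx1_unit (mulmx1C KCc).
  by rewrite -[T](mulmxK Cu) TCc mul0mx.
have [S [Sfree Sfull SI]] := IH _ _ _ _ r'b rphi1 rpsi1 tr1.
(* [p] is an equivariant retraction onto the kernel of [T]; [q] below is an equivariant section of
   the cokernel. *)
have [||p pK pI] := @hom_split _ _ _ _ psi _ Kk 1%:M Ck rpsi rpsi1.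
- move=> U x; rewrite !mulmx1 => KU.
  rewrite mulmxBr mulmxA KU mul0mx sub0r mulmxA.
  have : (Kk *m psi x <= N)%MS by apply: submx_trans (sN x); apply: submxMr.
  move/subk; rewrite submx0 subr_eq0 => /eqP ->.
  by rewrite -!mulmxA KU !mulmx0 oppr0.
- by move=> x; rewrite mulmx1 mulmxBr !mulmxA KCk mul1mx subrr.
rewrite !mulmx1 KCk in pK.
have [||q qC qI] := @hom_split _ _ _ _ _ phi 1%:M Cc Kc rphi1 rphi.
- move=> U x; rewrite !mul1mx => UC.
  rewrite mulmxBl -(mulmxA _ U) UC mulmx0 subr0.
  have /submxP [w ->] : (U <= I)%MS by apply: (sub_quot0 qc); rewrite ?submx1.
  by apply: (quot0_sub qc); rewrite -mulmxA; apply: mulmx_sub.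
- by move=> x; rewrite mul1mx mulmxBl -[X in _ - X]mulmxA KCc mulmx1 subrr.
rewrite !mul1mx KCc in qC.
(* If [v] is killed, passing to the cokernel gives [v p S = 0], so [v p = 0] and then [v T = 0].
   Thus [v] lies in the kernel, where [p] is injective. *)
have Ufree : row_free (T + p *m S *m q).
  rewrite -kermx_eq0; apply/eqP/row_matrixP => i; rewrite row0; set v := row i _.
  have vU : v *m (T + p *m S *m q) = 0 by rewrite -row_mul mulmx_ker row0.
  have vp : v *m p = 0.
    move/(congr1 (mulmxr Cc)): (vU); rewrite /= mul0mx -mulmxA mulmxDl TCc add0r.
    rewrite -!mulmxA qC mulmx1 mulmxA => /eqP.
    by rewrite mulmx_free_eq0 // => /eqP.
  have vT : v *m T = 0.
    by move: vU; rewrite mulmxDr !mulmxA vp !mul0mx addr0.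
  move/NP: vT => /subk; rewrite submx0 subr_eq0 => /eqP vE.
  by move: vp; rewrite vE -!mulmxA pK mulmx1 => vC; rewrite mulmxA vC mul0mx.
exists (T + p *m S *m q); split=> //.
  by rewrite /row_full (eqP Ufree) mk.
move=> x; rewrite mulmxDl mulmxDr TI; congr (_ + _).
by rewrite -(mulmxA (p *m S)) qI (mulmxA (p *m S)) -(mulmxA p S) SI (mulmxA p) pI !mulmxA.
Qed.

End Isomorphism.

(** * Specialising the characteristic polynomial to the Cartan subalgebra *)

Lemma lie_charpoly_trace (F : numClosedFieldType) (L : vectType F) (br : L -> L -> L)
    n (Phi : finType) (hc : 'I_n -> L) (E : Phi -> L) m k
    (phi : L -> 'M[F]_m) (psi : L -> 'M[F]_k) (c : 'I_n -> F) x j :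
  lie_rep br phi -> lie_rep br psi -> lie_charpoly hc E phi = lie_charpoly hc E psi ->
  x = \sum_i c i *: hc i -> \tr (phi x ^+ j) = \tr (psi x ^+ j).
Proof.
move=> rphi rpsi eqf xE; apply: trace_pow_char_poly.
(* Substituting ['X] for [z_0], [- c i] for [z_i] and 0 for the root variables turns the determinant
   into that of ['X - rho x]. *)
pose v (i : 'I_(1 + n + #|Phi|)) : {poly F} := match split i with
  | inl i1 => match split i1 with inl _ => 'X | inr i2 => (- c i2)%:P end
  | inr _ => 0 end.
suff E1 d (rho : L -> 'M[F]_d) : lie_rep br rho ->
    mmap polyC v (lie_charpoly hc E rho) = char_poly (rho x).
  by rewrite -!E1 // eqf.
case=> lin _; rewrite /lie_charpoly /char_poly -det_map_mx; congr (\det _).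
rewrite xE (lin_sum lin) !map_mxD !map_mx_sum.
have vz (i : 'I_(1 + n + #|Phi|)) : mmap polyC v 'X_i = v i by rewrite mmapX mmap1U.
have splitl p q (i : 'I_p) : split (lshift q i) = inl i
  by rewrite -[lshift _ _]/(unsplit (inl i)) unsplitK.
have splitr p q (i : 'I_q) : split (rshift p i) = inr i
  by rewrite -[rshift _ _]/(unsplit (inr i)) unsplitK.
apply/matrixP => a b; rewrite !mxE !summxE.
rewrite [X in _ + X]big1 ?addr0 => [|r _]; last first.
  by rewrite !mxE /= rmorphM /= vz /v splitr mul0r.
rewrite /= raddfMn /= vz /v !splitl; congr (_ + _).
rewrite rmorph_sum -sumrN; apply: eq_bigr => i _.
by rewrite !mxE /= rmorphM /= vz /v splitl splitr mmapC (linZ lin) mxE rmorphM /= rmorphN mulNr.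
Qed.

Theorem theorem3p3 (R : realType) (L : vectType R[i]) (br : L -> L -> L)
  (h : {vspace L}) (Phi : finType) (alpha : Phi -> L -> R[i])
  (n : nat) (s : 'I_n -> Phi) (hc : 'I_n -> L) (E : Phi -> L)
  (m k : nat) (phi : L -> 'M[R[i]]_m) (psi : L -> 'M[R[i]]_k) :
  simple_lie br ->
  canonical_basis_data br h alpha s hc E ->
  lie_rep br phi -> lie_rep br psi ->
  lie_charpoly hc E phi = lie_charpoly hc E psi ->
  rep_iso phi psi.
Proof.
move=> simpL [[subh nilh normh] roots simp cor _] rphi rpsi eqf.
have lieL : lie_algebra br by case: simpL.
have [h0 h0h h0reg] := cartan_regular lieL subh nilh normh.
(* A simple coroot is needed to supply the sl2-triple. If there were none, [h] would be zero and
   self-normalizing, so [L] would be zero. *)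
have [n0|npos] := posnP n.
  case: simpL => _ [x [y nz]] _; case/eqP: nz.
  have h00 : h = 0%VS by case: simp => nE _ _; apply/eqP; rewrite -dimv_eq0 -nE n0.
  have x0 : x = 0.
    apply/eqP; rewrite -memv0 -h00; apply: normh => z.
    rewrite h00 memv0 => /eqP ->; rewrite memv0.
    by case: lieL => _ brr _ _; rewrite (lin0 (brr x)).
  by rewrite x0; case: lieL => brl _ _ _; apply: (lin0 (brl y)).
have [e [f [_ _ [he hf ef e0]]]] : exists e f, [/\
    in_weight_space br h (alpha (s (Ordinal npos))) e,
    in_weight_space br h (fun y => - alpha (s (Ordinal npos)) y) f &
    [/\ br (hc (Ordinal npos)) e = 2 *: e, br (hc (Ordinal npos)) f = - 2 *: f,
        br e f = hc (Ordinal npos) & e != 0]].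
  by case: (roots) => alin _ _ _ _; apply: coroot_sl2.
apply: (same_pow_traces_iso simpL he hf ef e0 h0h h0reg) => // x j xh.
have [c xE] := coroots_span lieL roots simp cor xh.
exact: (lie_charpoly_trace _ rphi rpsi eqf xE).
Qed.
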